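(* Assume that there exist a probability measure $\nu$ on $E$ and constants $t_0,c_1,c_2>0$ such that $$\mathbb{P}_x(X_{t_0}\in\cdot\mid t_0<\tau_\partial)\geq c_1\nu,\quad\forall x\in E,$$ and $$\mathbb{P}_\nu(t<\tau_\partial)\geq c_2\,\mathbb{P}_x(t<\tau_\partial),\quad\forall t\geq 0,\ x\in E.$$ Then, for all $\mu\in\mathcal{M}_1(E)$, all $f\in\mathcal{B}_b(E)$ and all $n\ge 1$, $$\left|\mu A^n f-\frac{\alpha(f)\mu(\eta)}{\lambda_0^n}\right|\leq \frac{(CC''+C')\|f\|_\infty}{(\lambda_0+\gamma)^n}.$$ Moreover, there is a constant $B$ (not depending on $\mu$, $n$, $t$) such that, for all $\mu\in\mathcal{M}_1(E)$ and all $n\geq 1$, $$\left\|\frac{\mu A^n}{\mu A^n\mathbf{1}}-\alpha\right\|_{TV}\leq \frac{B}{\mu(\eta)}\left(\frac{\lambda_0}{\lambda_0+\gamma}\right)^n,$$ and for all $\mu\in\mathcal{M}_1(E)$ and all $t\ge 0$, $$\left\|\frac{\mu e^{tA}}{\mu e^{tA}\mathbf{1}}-\alpha\right\|_{TV}\leq \frac{B}{\mu(\eta)}\, e^{-t\,\frac{\gamma}{\lambda_0(\lambda_0+\gamma)}}.$$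
   Context: $(X_t)_{t\ge0}$ is a time-homogeneous Markov process on a measurable space $E\cup\{\partial\}$, where $\partial\notin E$ is absorbing (if $X_s=\partial$ then $X_t=\partial$ for all $t\ge s$). $\tau_\partial=\inf\{t\ge0: X_t=\partial\}$ is assumed almost surely finite, and $\mathbb{P}_x(t<\tau_\partial)>0$ for all $t\ge0$, $x\in E$. $\mathbb{P}_\mu$ is the law of the process with initial distribution $\mu$. $\mathcal{B}_b(E)$ is the set of bounded measurable real functions on $E$, $\mathcal{M}_1(E)$ the set of probability measures on $E$, $\mathbf 1$ the constant function $1$ on $E$, and $\|\mu_1-\mu_2\|_{TV}=\sup_{f\in\mathcal{B}_b(E),\,\|f\|_\infty\le1}|\mu_1(f)-\mu_2(f)|$. Under the two conditions assumed in the claim, the following known facts hold (and fix the notation). There exist a unique quasi-stationary distribution $\alpha$ (i.e. $\mathbb{P}_\alpha(X_t\in\cdot\mid t<\tau_\partial)=\alpha$ for all $t\ge0$), a constant $\lambda_0>0$ with $\mathbb{P}_\alpha(t<\tau_\partial)=e^{-\lambda_0t}$ for all $t\ge 0$, a bounded function $\eta:E\to[0,\infty)$ with $\alpha(\eta)=1$, and constants $C,C',C'',\gamma>0$ such that, for all $t\ge0$, $x\in E$ and $\mu\in\mathcal{M}_1(E)$, $$\|\mathbb{P}_\mu(X_t\in\cdot\mid t<\tau_\partial)-\alpha\|_{TV}\le Ce^{-\gamma t},\qquad \left|e^{\lambda_0t}\mathbb{P}_x(t<\tau_\partial)-\eta(x)\right|\le C'e^{-\gamma t},\qquad \mathbb{P}_x(t<\tau_\partial)\le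 C''e^{-\lambda_0t}.$$ In addition, there exist $t_1>0$ and a constant $D$ with $De^{-\gamma t_1}\le 1/2$ such that, for all $t\ge t_1$ and $x\in E$, $\left|e^{\lambda_0t}\mathbb{P}_x(t<\tau_\partial)-\eta(x)\right|\le D\,\eta(x)e^{-\gamma t}$. The semigroup is $P_tf(x)=\mathbb{E}_x[f(X_t)\mathbf{1}_{t<\tau_\partial}]$ for $f\in\mathcal{B}_b(E)$. The Green operator $A$ is the bounded operator on $(\mathcal{B}_b(E),\|\cdot\|_\infty)$ defined by $$Af(x)=\mathbb{E}_x\left[\int_0^{\tau_\partial}f(X_s)\,ds\right]=\int_0^\infty P_sf(x)\,ds,$$ and $e^{tA}=\sum_{n\ge0}t^nA^n/n!$. For $\mu\in\mathcal{M}_1(E)$, $\mu A^nf=\int_E A^nf\,d\mu$, $\mu e^{tA}f=\int_E e^{tA}f\,d\mu$, and $\mu A^n$, $\mu e^{tA}$ denote the corresponding measures on $E$. *)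

(* Defs.v *)
From HB Require Import structures.
From mathcomp Require Import all_boot all_order all_algebra.
From mathcomp Require Import all_classical all_reals all_analysis.

Set Implicit Arguments.
Unset Strict Implicit.
Unset Printing Implicit Defensive.

Import Order.TTheory GRing.Theory Num.Theory.
Import numFieldNormedType.Exports.

Local Open Scope classical_set_scope.
Local Open Scope ring_scope.

(* The state space $E\cup\{\partial\}$ is [option E], with [None] as the
   cemetery point. Its measurable sets are the B such that $B\cap E$ is
   measurable in E; in particular E and $\{\partial\}$ are measurable. *)
Definition cemetery_display : measure_display -> measure_display.
Proof. exact. Qed.

Section cemetery_measurable.
Context (d : measure_display) (E : measurableType d).

Definition cemetery_measurable : set (set (option E)) :=
  [set B | measurable (Some @^-1` B)].

Let cemetery_measurable0 : cemetery_measurable set0.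
Proof. by rewrite /cemetery_measurable /= preimage_set0. Qed.

Let cemetery_measurableC B :
  cemetery_measurable B -> cemetery_measurable (~` B).
Proof.
by rewrite /cemetery_measurable /= preimage_setC; exact: measurableC.
Qed.

Let cemetery_measurable_bigcup (F : (set (option E))^nat) :
  (forall i, cemetery_measurable (F i)) ->
  cemetery_measurable (\bigcup_i F i).
Proof.
move=> mF; rewrite /cemetery_measurable /= preimage_bigcup.
by apply: bigcup_measurable => i _; exact: mF.
Qed.

HB.instance Definition _ := @isMeasurable.Build (cemetery_display d)
  (option E) cemetery_measurable cemetery_measurable0 cemetery_measurableC
  cemetery_measurable_bigcup.

End cemetery_measurable.

Section bounded_measurable.
Context (d : measure_display) (E : measurableType d) (R : realType).

Definition Bb : set (E -> R) :=
  [set f : E -> R | measurable_fun setT f /\ bounded_fun f].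

Definition supnorm (f : E -> R) : R := sup (range (fun x => `|f x|)).

Definition tv_dist (m1 m2 : set E -> \bar R) : \bar R :=
  ereal_sup
    [set `|\int[m1]_x (f x)%:E - \int[m2]_x (f x)%:E|%E
      | f in [set f | Bb f /\ supnorm f <= 1]].

End bounded_measurable.

(* Times are the nonnegative elements of R: the values of X at negative times
   never matter. *)
Section markov.
Context (R : realType) (d dO : measure_display)
  (E : measurableType d) (Omega : measurableType dO).
Variables (X : R -> Omega -> option E) (P : R.-pker (option E) ~> Omega).

Definition past (s : R) : set (set Omega) :=
  <<s [set A | exists u B, [/\ 0 <= u <= s, measurable B & A = X u @^-1` B]] >>.

(* Time-homogeneous Markov process for its natural filtration, [P x] being the
   law of the process started from x. Joint measurability in (t, omega) is what
   gives a meaning to the expectation of $\int_0^{\tau_\partial} f(X_s)ds$.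
   The initial condition is expressed with a Dirac mass because singletons of E
   need not be measurable; the last field says that
   $P_x(X_{s+t}\in B | F_s) = P_{X_s}(X_t\in B)$. *)
Record markov_process : Prop := {
  markov_measurable :
    measurable_fun [set p : measurableTypeR R * Omega | 0 <= p.1]
      (fun p => X p.1 p.2) ;
  markov_start : forall (x : option E) (B : set (option E)), measurable B ->
    P x (X 0 @^-1` B) = \d_x B ;
  markov_property : forall (x : option E) (s t : R) (A : set Omega)
      (B : set (option E)),
    0 <= s -> 0 <= t -> past s A -> measurable B ->
    P x (A `&` X (s + t) @^-1` B) =
      (\int[P x]_(w in A) P (X s w) (X t @^-1` B))%E }.

Definition absorbing : Prop :=
  forall (s t : R) (w : Omega), 0 <= s -> s <= t ->
    X s w = None -> X t w = None.

Definition tau (w : Omega) : \bar R :=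
  ereal_inf [set t%:E | t in [set t | 0 <= t /\ X t w = None]].

Definition alive (t : R) : set Omega := [set w | (t%:E < tau w)%E].

Definition law (mu : probability E R) (A : set Omega) : \bar R :=
  (\int[mu]_x P (Some x) A)%E.

(* $Q(X_t\in\cdot | t<\tau_\partial)$, as a set function on E *)
Definition cond_law (Q : set Omega -> \bar R) (t : R) (B : set E) : \bar R :=
  (fine (Q (X t @^-1` (Some @` B) `&` alive t)) / fine (Q (alive t)))%:E.

Definition quasi_stationary (alpha : probability E R) : Prop :=
  forall (t : R) (B : set E), 0 <= t -> measurable B ->
    cond_law (law alpha) t B = alpha B.

(* $A f(x) = E_x[\int_0^{\tau_\partial} f(X_s) ds]$; the default value of [oapp]
   is never used, since X is in E before $\tau_\partial$. *)
Definition green (f : E -> R) (x : E) : R :=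
  fine (\int[P (Some x)]_w
          \int[lebesgue_measure]_(s in [set s : R | (0 <= s)%R /\ s%:E < tau w])
            (oapp f 0%R (X s w))%:E)%E.

Definition green_iter (n : nat) (f : E -> R) : E -> R := iter n green f.

(* The series of operators converges in operator norm, hence its sum is also
   the pointwise one. *)
Definition green_exp (t : R) (f : E -> R) (x : E) : R :=
  limn (series (fun n => t ^+ n / n`!%:R * green_iter n f x)).

End markov.

(* For an operator T on functions, $\mu T f$ and the normalized measure
   $\mu T / \mu T\mathbf{1}$. *)
Section normalized.
Context (R : realType) (d : measure_display) (E : measurableType d).

Definition act (mu : probability E R) (T : (E -> R) -> E -> R) (f : E -> R)
  : R := Rintegral mu setT (T f).

Definition normalized (mu : probability E R) (T : (E -> R) -> E -> R)
  (B : set E) : \bar R :=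
  (act mu T (\1_B) / act mu T (cst 1))%:E.

End normalized.

(* Main.v *)
Require Import Defs.
From HB Require Import structures.
From mathcomp Require Import all_boot all_order all_algebra.
From mathcomp Require Import all_classical all_reals all_analysis.
From mathcomp Require Import measurable_realfun ring lra.

(** The Green operator is the Laplace transform at 0 of the killed semigroup,
    so it inherits the spectral gap of that semigroup. Write
    Q_s f(x) = E_x[f(X_s); X_s <> None], K = C C'' + C' and
    kappa = lambda0 + gamma. For almost every s > 0,
      |Q_s f(x) - alpha(f) eta(x) e^(-lambda0 s)| <= K |f| e^(-kappa s)
    ([transition_estimate]): given survival the law of X_s is C e^(-gamma s)
    close to alpha, the survival probability is at most C'' e^(-lambda0 s), and
    once multiplied by e^(lambda0 s) it is C' e^(-gamma s) close to eta. Since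
    A f is the integral over r > 0 of Q_r f, and Q_s A f that of Q_(s+r) f
    ([green_transition], [transition_green]), integrating this estimate in time
    divides its main term by lambda0 and its error term by kappa. By induction,
    Q_s A^n f is estimated with the constants divided by lambda0^n and kappa^n
    ([green_iter_transition]), which avoids any formula for the kernel of A^n.
    Summing over n against t^n / n! yields the analogue for e^(tA), with
    e^(t / lambda0) and e^(t / kappa) ([green_exp_estimate]).

    The normalized bounds follow from |L f - alpha(f) k| <= b |f|, where
    L = mu T and k > 0 ([tv_dist_normalized_le]). If L 1 >= k / 2, dividing by
    L 1 costs at most 2 b / L 1 <= 4 b / k; otherwise b >= k / 2, and the
    trivial bound 2 on the distance is already at most 4 b / k. Here k is
    mu(eta) / lambda0^n or mu(eta) e^(t / lambda0), and mu(eta) > 0 because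
    eta(x) = 0 would, by the relative estimate, force P_x(t1 < tau) = 0.

    Two points of measure theory remain. First, the distances integrate
    functions against set functions such as B |-> mu A^n 1_B / mu A^n 1, and
    these integrals have to be identified. This is Daniell's theorem
    ([integral_daniell_measure]): a positive linear functional on bounded
    measurable functions that is continuous along bounded pointwise convergence
    is the integral against its values on indicators. The operators that are
    Daniell functionals at each point are stable under composition and
    exponential, and contain A ([bounded_operator_comp],
    [bounded_operator_exp], [green_operator]). Second, survival is expressed by
    s < tau, whereas the Markov property speaks of X_s <> None. These events
    may differ with positive probability, but for a given starting point only
    at countably many times s ([countable_fleeting]), which a time integral
    does not see. *)

Set Implicit Arguments.
Unset Strict Implicit.
Unset Printing Implicit Defensive.

Import Order.TTheory GRing.Theory Num.Theory.
Import numFieldNormedType.Exports.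

Local Open Scope classical_set_scope.
Local Open Scope ring_scope.

(** * Bounded measurable functions *)
Lemma Rintegral_dominated_cvg (R : realType) (d : measure_display)
    (T : measurableType d) (m : {measure set T -> \bar R}) (A : set T)
    (f_ : nat -> T -> R) (f g : T -> R) :
  measurable A ->
  (forall n, measurable_fun A (f_ n)) -> measurable_fun A f ->
  (forall x, A x -> f_ ^~ x @ \oo --> f x) ->
  m.-integrable A (EFin \o g) ->
  (forall n x, A x -> `|f_ n x| <= g x) ->
  Rintegral m A (f_ n) @[n --> \oo] --> Rintegral m A f.
Proof.
move=> mA mf_ mf ff ig fg.
have [ifA _ cv] : [/\ m.-integrable A (EFin \o f),
   [sequence \int[m]_(x in A) `|(f_ n x)%:E - (f x)%:E|]_n @ \oo --> 0 &
   [sequence \int[m]_(x in A) (f_ n x)%:E]_n @ \oo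
     --> \int[m]_(x in A) (f x)%:E]%E.
  apply: (@dominated_convergence _ _ _ m A mA
    (fun n => EFin \o f_ n) (EFin \o f) (EFin \o g)) => //.
  - by move=> n; apply/measurable_EFinP.
  - exact/measurable_EFinP.
  - by apply: aeW => x Ax; apply: cvg_EFin; [exact: nearW|exact: ff].
  - by apply: aeW => x n Ax; rewrite lee_fin fg.
apply: fine_cvg; rewrite fineK; first exact: cv.
exact: integrable_fin_num ifA.
Qed.

Section bounded_functions.
Context (R : realType) (d : measure_display) (T : measurableType d).
Implicit Types (f g : T -> R) (m : {finite_measure set T -> \bar R}).

Lemma Bb_le f M :
  measurable_fun setT f -> (forall x, `|f x| <= M) -> Bb f.
Proof.
move=> mf fM; split=> //; exists M; split; first exact: num_real.
by move=> N MN x _; exact: le_trans (fM x) (ltW MN).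
Qed.

Lemma supnorm_ub f x : Bb f -> `|f x| <= supnorm f.
Proof.
move=> [_ [M [_ fM]]]; apply: ub_le_sup; last by exists x.
by exists (M + 1) => _ [y _ <-]; apply: (fM (M + 1)) => //; rewrite ltrDl.
Qed.

Lemma supnorm_ge0 f (x : T) : Bb f -> 0 <= supnorm f.
Proof. by move=> bf; apply: le_trans (supnorm_ub x bf). Qed.

Lemma Bb_integrable m f : Bb f -> m.-integrable setT (EFin \o f).
Proof.
move=> [mf bf]; apply: measurable_bounded_integrable => //.
exact: fin_num_fun_lty (fin_num_measure m).
Qed.

Lemma Bb_cst (k : R) : Bb (cst k : T -> R).
Proof. by apply: (@Bb_le _ `|k|) => // ; exact: measurable_cst. Qed.

Lemma Bb_indic (B : set T) : measurable B -> Bb (\1_B : T -> R).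
Proof.
move=> mB; apply: (@Bb_le _ 1) => [|x].
  exact: measurable_realfun.measurable_indic.
by rewrite indicE; case: (_ \in _); rewrite ?normr1 ?normr0.
Qed.

Lemma Bb_add f g : Bb f -> Bb g -> Bb (f \+ g).
Proof.
move=> bf bg; apply: (@Bb_le _ (supnorm f + supnorm g)) => [|x].
  by apply: measurable_funD; [case: bf|case: bg].
by rewrite (le_trans (ler_normD _ _))// lerD// supnorm_ub.
Qed.

Lemma Bb_scale (k : R) f : Bb f -> Bb (fun x => k * f x).
Proof.
move=> bf; apply: (@Bb_le _ (`|k| * supnorm f)) => [|x].
  by apply: measurable_funM => //; case: bf.
by rewrite normrM ler_wpM2l// supnorm_ub.
Qed.

Lemma Bb_RintegralE m f : Bb f ->
  (\int[m]_x (f x)%:E = (Rintegral m setT f)%:E)%E.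
Proof.
by move=> bf; rewrite /Rintegral fineK//; exact: integrable_fin_num (Bb_integrable _ _).
Qed.

Lemma Bb_shift_ge0 f x : Bb f -> 0 <= f x + supnorm f.
Proof.
move=> bf; have := supnorm_ub x bf; rewrite ler_norml => /andP[+ _].
by rewrite -subr_ge0 opprK.
Qed.

Lemma supnorm_le f (M : R) : (exists x : T, True) -> (forall x, `|f x| <= M) ->
  supnorm f <= M.
Proof.
move=> [x _] fM; apply: ge_sup; first by exists `|f x|; exists x.
by move=> _ [y _ <-].
Qed.

Lemma probability_Rintegral1 (m : probability T R) : Rintegral m setT (cst 1) = 1.
Proof.
rewrite (_ : cst 1 = fun=> 1)// Rintegral_cst// mul1r.
by have /= -> := @probability_setT _ _ _ m.
Qed.

Lemma probability_nonempty (m : probability T R) : exists x : T, True.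
Proof.
apply: contrapT => nT; have := probability_setT m.
rewrite (_ : [set: T] = set0) ?measure0//.
  by move/eqP; rewrite eqe eq_sym oner_eq0.
by rewrite -subset0 => x _; apply: nT; exists x.
Qed.

Lemma Bb_Rintegral_cvg m (f_ : nat -> T -> R) f M :
  (forall n, measurable_fun setT (f_ n)) ->
  (forall n x, `|f_ n x| <= M) ->
  (forall x, f_ ^~ x @ \oo --> f x) ->
  Rintegral m setT (f_ n) @[n --> \oo] --> Rintegral m setT f.
Proof.
move=> mf_ fM ff.
have mf : measurable_fun setT f.
  by apply: (measurable_fun_cvg mf_) => x _; exact: ff.
apply: (Rintegral_dominated_cvg (g := cst M)) => //.
exact: Bb_integrable (Bb_cst M).
Qed.
End bounded_functions.

(** * Daniell functionals *)
Section integral_raw.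
Context (R : realType) (d : measure_display) (T : measurableType d).
Import HBNNSimple.

(** The set functions occurring in the total variation distances are arbitrary
    on nonmeasurable sets and carry no measure structure. Integrals only read
    the level sets of simple functions, so such a set function may be exchanged
    for a genuine measure. *)
Lemma eq_integral_measurable (m1 m2 : set T -> \bar R) (f : T -> \bar R) :
  (forall A, measurable A -> m1 A = m2 A) ->
  (\int[m1]_x f x = \int[m2]_x f x)%E.
Proof.
move=> m12.
have E (h : {nnsfun T >-> R}) : sintegral m1 h = sintegral m2 h.
  by apply: eq_fsbigr => r _; rewrite m12.
rewrite /integral.
by congr (ereal_sup _ - ereal_sup _)%E; apply: eq_imagel => h _; exact: E.
Qed.
End integral_raw.

(** Continuity is asked along bounded pointwise convergence rather than along
    monotone convergence: in this form it passes through compositions, time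
    integrals and series, with dominated convergence at each stage. *)
Record daniell (R : realType) (d : measure_display) (T : measurableType d)
    (L : (T -> R) -> R) : Prop := {
  daniellD : forall f g, Bb f -> Bb g -> L (f \+ g) = L f + L g ;
  daniellZ : forall k f, Bb f -> L (fun x => k * f x) = k * L f ;
  daniell_ge0 : forall f, Bb f -> (forall x, 0 <= f x) -> 0 <= L f ;
  daniell_cvg : forall (f_ : nat -> T -> R) (f : T -> R) (M : R),
    (forall n, measurable_fun setT (f_ n)) ->
    (forall n x, `|f_ n x| <= M) -> (forall x, f_ ^~ x @ \oo --> f x) ->
    L (f_ n) @[n --> \oo] --> L f }.

Section daniell_theory.
Import HBNNSimple.
Context (R : realType) (d : measure_display) (T : measurableType d).
Implicit Types (L : (T -> R) -> R) (f g : T -> R).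

Lemma Rintegral_daniell (m : {finite_measure set T -> \bar R}) :
  daniell (Rintegral m setT).
Proof.
split=> [f g bf bg|k f bf|f bf f0|f_ f M].
- by rewrite RintegralD//; exact: Bb_integrable.
- by rewrite RintegralZl//; exact: Bb_integrable.
- by apply: Rintegral_ge0.
- exact: Bb_Rintegral_cvg.
Qed.

Lemma daniell0 L : daniell L -> L (cst 0) = 0.
Proof.
move=> HL; have := daniellZ HL 0 (Bb_cst T (0 : R)).
by under [X in L X]funext do rewrite mul0r; rewrite mul0r.
Qed.

Lemma daniell_sum L (f_ : nat -> T -> R) n : daniell L ->
  (forall i, Bb (f_ i)) ->
  Bb (fun x => \sum_(i < n) f_ i x) /\
  L (fun x => \sum_(i < n) f_ i x) = \sum_(i < n) L (f_ i).
Proof.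
move=> HL bf; elim: n => [|n [bS LS]].
  rewrite big_ord0; under [X in Bb X]funext do rewrite big_ord0.
  by split; [exact: (Bb_cst T 0)|under [X in L X]funext do rewrite big_ord0; exact: daniell0].
have -> : (fun x => \sum_(i < n.+1) f_ i x) =
          (fun x => \sum_(i < n) f_ i x) \+ f_ n.
  by apply/funext => x; rewrite big_ord_recr.
by split; [exact: Bb_add|rewrite (daniellD HL)// big_ord_recr LS].
Qed.

(** A nonnegative bounded function is a bounded pointwise limit of simple
    functions, which are combinations of indicators; adding its norm makes any
    bounded function nonnegative. *)
Lemma daniell_unique L L' : daniell L -> daniell L' ->
  (forall B, measurable B -> L \1_B = L' \1_B) ->
  forall f, Bb f -> L f = L' f.
Proof.
move=> HL HL' LL'.
have pos f : Bb f -> (forall x, 0 <= f x) -> L f = L' f.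
  move=> bf f0; have mf : measurable_fun setT (EFin \o f).
    by apply/measurable_EFinP; case: bf.
  pose g := nnsfun_approx measurableT mf.
  have gf x : (fun n => g n x) @ \oo --> f x.
    have /fine_cvgP[_] := @cvg_nnsfun_approx _ _ _ _ measurableT _ mf
      (fun x _ => f0 x : (0 <= (EFin \o f) x)%E) x I.
    by [].
  have gS n x : g n x <= f x.
    rewrite -(cvg_lim _ (gf x))//; apply: nondecreasing_cvgn_le.
      by move=> i j ij; exact/lefP/nd_nnsfun_approx.
    by apply/cvg_ex; exists (f x).
  have gM n x : `|g n x| <= supnorm f.
    rewrite ger0_norm// (le_trans (gS n x))// (le_trans (ler_norm _))//.
    exact: supnorm_ub.
  have Lg n : L (g n) = L' (g n).
    pose s : seq R := finmap.enum_fset (fset_set (range (g n))).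
    pose h i x := s`_i * \1_(g n @^-1` [set s`_i]) x.
    have -> : g n = (fun x => \sum_(i < size s) h i x) :> (T -> R).
      by apply/funext => x; rewrite {1}(fimfunEord (g n)).
    have bh i : Bb (h i) by apply: Bb_scale; exact: Bb_indic.
    rewrite (daniell_sum _ HL bh).2 (daniell_sum _ HL' bh).2.
    apply: eq_bigr => i _.
    rewrite (daniellZ HL) ?(daniellZ HL'); try exact: Bb_indic.
    by rewrite LL'.
  have c1 : L (g n) @[n --> \oo] --> L f by exact: (daniell_cvg HL _ gM gf).
  have c2 : L (g n) @[n --> \oo] --> L' f.
    by under eq_fun do rewrite Lg; exact: (daniell_cvg HL' _ gM gf).
  exact: cvg_unique c1 c2.
move=> f bf; pose M := supnorm f.
have bM : Bb (cst M : T -> R) by exact: Bb_cst.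
have bN : Bb (cst 1 : T -> R) by exact: Bb_cst.
have fE : f = (f \+ cst M) \+ (fun x => - M * cst 1 x).
  by apply/funext => x; rewrite /= mulr1 addrK.
have bfM : Bb (f \+ cst M) by exact: Bb_add.
have -> : L f = L (f \+ cst M) - M * L (cst 1).
  by rewrite {1}fE (daniellD HL)// ?(daniellZ HL) ?mulNr//; exact: Bb_scale.
have -> : L' f = L' (f \+ cst M) - M * L' (cst 1).
  by rewrite {1}fE (daniellD HL')// ?(daniellZ HL') ?mulNr//; exact: Bb_scale.
by rewrite !pos// => x; exact: Bb_shift_ge0.
Qed.

(** Positivity applied to M + f and M - f. *)
Lemma daniell_norm L f (M : R) : daniell L -> measurable_fun setT f ->
  (forall x, `|f x| <= M) -> `|L f| <= M * L (cst 1).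
Proof.
move=> HL mf fM; have bf : Bb f by exact: Bb_le mf fM.
have b1 : Bb (cst 1 : T -> R) by exact: Bb_cst.
have key (k : R) : `|k| = 1 -> 0 <= M * L (cst 1) + k * L f.
  move=> k1; rewrite -!(daniellZ HL)// -(daniellD HL); try exact: Bb_scale.
  apply: (daniell_ge0 HL) => [|x]; first by apply: Bb_add; exact: Bb_scale.
  rewrite /= mulr1; have := fM x; rewrite -(mul1r `|f x|) -k1 -normrM ler_norml.
  by case/andP; rewrite -subr_ge0 opprK addrC.
rewrite ler_norml; apply/andP; split.
  by have := key 1 (normr1 _); rewrite mul1r addrC -lerBlDr sub0r.
by have := key (-1) (normrN1 _); rewrite mulN1r subr_ge0.
Qed.

Lemma daniell_div L k : daniell L -> 0 <= k -> daniell (fun f => L f / k).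
Proof.
move=> HL k0; split=> [f g bf bg|c f bf|f bf f0|f_ f M mf fM ff].
- by rewrite (daniellD HL)// mulrDl.
- by rewrite (daniellZ HL)// mulrA.
- by rewrite divr_ge0//; exact: (daniell_ge0 HL).
- by apply: cvgMl; exact: (daniell_cvg HL mf fM ff).
Qed.

Section daniell_measure.
Variables (L : (T -> R) -> R) (HL : daniell L).

(** The absolute value only acts on nonmeasurable sets, on which a measure must
    be nonnegative too. *)
Definition daniell_measure (B : set T) : \bar R := `|L \1_B|%:E.

Let dm0 : daniell_measure set0 = 0%E.
Proof. by rewrite /daniell_measure indic0 (daniell0 HL) normr0. Qed.

Let dm_ge0 B : (0 <= daniell_measure B)%E.
Proof. by rewrite lee_fin. Qed.

Lemma daniell_measureE B : measurable B -> daniell_measure B = (L \1_B)%:E.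
Proof.
move=> mB; rewrite /daniell_measure ger0_norm//.
by apply: (daniell_ge0 HL) => [|x]; [exact: Bb_indic|rewrite indicE].
Qed.

Let dm_sigma : semi_sigma_additive daniell_measure.
Proof.
move=> F mF tF mUF.
(* the sets being disjoint, S n is bounded by 1 and tends to the indicator of
   the union *)
pose S n x : R := \sum_(i < n) \1_(F i) x.
have Sin i0 x n : F i0 x -> S n x = (i0 < n)%N%:R.
  move=> Fx; rewrite /S.
  have -> : \sum_(i < n) (\1_(F i) x : R) = \sum_(i < n) (i == i0 :> nat)%:R.
    apply: eq_bigr => i _; rewrite indicE; congr (_ %:R); congr nat_of_bool.
    apply/idP/eqP => [/set_mem Fi|->]; last exact: mem_set.
    by apply: (tF _ _ I I); exists x.
  have [ni|ni] := ltnP i0 n.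
    rewrite (bigD1 (Ordinal ni))//= eqxx big1 ?addr0// => j.
    by rewrite -val_eqE/= => /negbTE->.
  by rewrite big1// => j _; rewrite ltn_eqF// (leq_trans _ ni).
have Sout x n : ~ (\bigcup_i F i) x -> S n x = 0.
  move=> Fx; rewrite /S big1// => i _; rewrite indicE memNset//.
  by apply: contra_not Fx => Fi; exists i.
have LS n : (L (S n))%:E = \sum_(0 <= i < n) daniell_measure (F i).
  rewrite big_mkord /S (daniell_sum _ HL (fun i => Bb_indic R (mF i))).2.
  by rewrite -sumEFin; apply: eq_bigr => i _; rewrite daniell_measureE.
under eq_fun do rewrite -LS; rewrite daniell_measureE//.
apply: cvg_EFin; first exact: nearW.
apply: (daniell_cvg HL (M := 1)) => [n|n x|x].
- by case: (daniell_sum n HL (fun i => Bb_indic R (mF i))).1.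
- have [[i _ Fx]|Fx] := pselect ((\bigcup_i F i) x).
    by rewrite (Sin i)//; case: ltnP; rewrite ?normr1 ?normr0.
  by rewrite Sout// normr0.
- have [[i _ Fx]|Fx] := pselect ((\bigcup_i F i) x).
    rewrite indicE mem_set; last by exists i.
    apply: cvg_near_cst; exists i.+1 => // n /= ni.
    by rewrite (Sin i)// ni.
  rewrite indicE memNset//; apply: cvg_near_cst; apply: nearW => n.
  by rewrite Sout.
Qed.

HB.instance Definition _ := isMeasure.Build _ _ _ daniell_measure
  dm0 dm_ge0 dm_sigma.

Let dm_fin : fin_num_fun daniell_measure.
Proof. by move=> B mB; rewrite daniell_measureE. Qed.
HB.instance Definition _ :=
  Measure_isFinite.Build _ _ _ daniell_measure dm_fin.

(** Integration against the measure is itself a Daniell functional, and it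
    agrees with L on indicators. *)
Lemma integral_daniell_measure f : Bb f ->
  (\int[fun B => (L \1_B)%:E]_x (f x)%:E = (L f)%:E)%E.
Proof.
move=> bf; rewrite (@eq_integral_measurable _ _ _ _ daniell_measure); last first.
  by move=> A mA; rewrite daniell_measureE.
rewrite -(daniell_unique (Rintegral_daniell daniell_measure) HL)//.
  exact: Bb_RintegralE.
move=> B mB; rewrite /Rintegral integral_indic// setIT.
by rewrite [X in fine X]daniell_measureE.
Qed.
End daniell_measure.
End daniell_theory.

Section normalized_distance.
Context (R : realType) (d : measure_display) (T : measurableType d).
Implicit Types (L : (T -> R) -> R) (f g : T -> R).

(** When L 1 >= k / 2, the numerator is off by b and the denominator by b, hence
    an error 2 b / L 1. When L 1 < k / 2, the hypothesis at f = 1 gives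
    b > k / 2, so the bound exceeds 2, which dominates the distance because
    |L f| <= L 1. *)
Lemma tv_dist_normalized_le L (alpha : probability T R) (k b : R) :
  daniell L -> 0 < k ->
  (forall f, Bb f -> `|L f - Rintegral alpha setT f * k| <= b * supnorm f) ->
  (tv_dist (fun B => (L \1_B / L (cst 1))%:E) alpha <= (4 * b / k)%:E)%E.
Proof.
move=> HL k0 Lb; have [x0 _] := probability_nonempty alpha.
have b1 : Bb (cst 1 : T -> R) by exact: Bb_cst.
have Ha := Rintegral_daniell alpha.
have a1 := probability_Rintegral1 alpha.
have L1_ge0 : 0 <= L (cst 1) by apply: (daniell_ge0 HL).
have Lk : `|L (cst 1) - k| <= b.
  have := Lb _ b1; rewrite a1 mul1r => /le_trans; apply.
  have b0 : 0 <= b * supnorm (cst 1 : T -> R) by exact: le_trans (Lb _ b1).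
  have s1 : supnorm (cst 1 : T -> R) = 1.
    apply/eqP; rewrite eq_le supnorm_le/=; [|by exists x0|by rewrite normr1].
    by have := supnorm_ub x0 b1; rewrite /= normr1.
  by rewrite s1 mulr1.
have b0 : 0 <= b by exact: le_trans Lk.
have HL' := daniell_div HL L1_ge0.
apply: ge_ereal_sup => _ [f [bf f1] <-].
have fM x : `|f x| <= 1 by exact: le_trans (supnorm_ub x bf) f1.
have -> := integral_daniell_measure HL' bf.
rewrite (Bb_RintegralE alpha bf) -EFinB abse_EFin lee_fin.
have mf : measurable_fun setT f by case: bf.
have := daniell_norm HL mf fM; have := daniell_norm Ha mf fM.
have := Lb _ bf; rewrite a1 !mul1r.
set u := L f; set v := L (cst 1) in L1_ge0 Lk *; set a := Rintegral alpha setT f.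
move=> uak a_le1 uv; have {}uak : `|u - a * k| <= b.
  by rewrite (le_trans uak)// -[leRHS]mulr1 ler_wpM2l.
rewrite ler_pdivlMr//.
have [kv|vk] := leP (k / 2) v.
  have v0 : 0 < v by apply: lt_le_trans kv; rewrite divr_gt0.
  have -> : u / v - a = (u - a * k - a * (v - k)) / v.
    by field; rewrite gt_eqF.
  rewrite normrM normfV (gtr0_norm v0) mulrAC ler_pdivrMr//.
  have : `|u - a * k - a * (v - k)| <= 2 * b.
    rewrite (le_trans (ler_normB _ _))// mulr_natl mulr2n lerD// normrM.
    by rewrite (le_trans _ Lk)// ler_piMl.
  move=> /(ler_wpM2r (ltW k0)) /le_trans; apply.
  rewrite (_ : 4 * b * v = 2 * b * (2 * v)); last by ring.
  by rewrite ler_wpM2l ?mulr_ge0// mulrC -ler_pdivrMr.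
have kb : k / 2 <= b.
  move: Lk; rewrite ler_distlC => /andP[_]; lra.
suff h : `|u / v - a| <= 2.
  by rewrite (le_trans (ler_wpM2r (ltW k0) h))//; lra.
rewrite (le_trans (ler_normB _ _))// -[leRHS]/(1 + 1) lerD//.
have [v0|v0] := eqVneq v 0; first by rewrite v0 invr0 mulr0 normr0.
have {}v0 : 0 < v by rewrite lt_neqAle eq_sym v0.
by rewrite normrM normfV (gtr0_norm v0) ler_pdivrMr// mul1r.
Qed.
End normalized_distance.

(** * Operators defined by Daniell functionals *)
Section dominated_series.
Context (R : realType).
Implicit Types (u b : nat -> R).

Lemma dominated_series u b : (forall k, `|u k| <= b k) -> cvgn (series b) ->
  cvgn (series u) /\
  forall K, `|limn (series u) - series u K| <= limn (series b) - series b K.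
Proof.
move=> ub cb; have cu : cvgn (series u).
  apply: normed_cvg; apply: series_le_cvg cb => //= n.
  by apply: le_trans (ub n).
split=> // K.
have c1 : `|series u n - series u K| @[n --> \oo] -->
          `|limn (series u) - series u K|.
  by apply: cvg_norm; apply: cvgB => //; exact: cvg_cst.
have c2 : series b n - series b K @[n --> \oo] --> limn (series b) - series b K.
  by apply: cvgB => //; exact: cvg_cst.
apply: (ler_cvg_to c1 c2); exists K => // n /= Kn.
rewrite !sub_series_geq//; apply: le_trans (ler_norm_sum _ _ _) _.
by apply: ler_sum.
Qed.

(** Tannery's theorem: cut the series at K where the tail of b is below e / 3;
    the head is a finite sum. *)
Lemma dominated_series_limit (u : nat -> nat -> R) (v : nat -> R) b :
  (forall n k, `|u n k| <= b k) -> cvgn (series b) ->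
  (forall k, u n k @[n --> \oo] --> v k) ->
  limn (series (u n)) @[n --> \oo] --> limn (series v).
Proof.
move=> ub cb uv.
have vb k : `|v k| <= b k.
  apply: (ler_cvg_to (cvg_norm (uv k)) (@cvg_cst _ (b k) _ _ _)).
  exact: nearW.
apply/cvgrPdist_le => e e0.
have e3 : 0 < e / 3 by rewrite divr_gt0.
have [K _ bK] := (cvgrPdist_le _ _).1 cb _ e3.
have {}bK : limn (series b) - series b K <= e / 3.
  by rewrite (le_trans (ler_norm _))// bK /=.
have cS : series (u n) K @[n --> \oo] --> series v K.
  elim: K {bK} => [|K IH]; rewrite /series /=.
    by under eq_fun do rewrite big_geq//; rewrite big_geq//; exact: cvg_cst.
  under eq_fun do rewrite big_nat_recr//=.
  by rewrite big_nat_recr//=; exact: cvgD.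
have [N _ uN] := (cvgrPdist_le _ _).1 cS _ e3.
exists N => // n /= Nn; have {}uN := uN _ Nn.
have h1 := le_trans ((dominated_series vb cb).2 K) bK.
have h2 := le_trans ((dominated_series (ub n) cb).2 K) bK.
rewrite distrC in h2.
have -> : limn (series v) - limn (series (u n)) =
  (limn (series v) - series v K) + (series v K - series (u n) K) +
  (series (u n) K - limn (series (u n))) by ring.
rewrite (le_trans (ler_normD _ _))// (_ : e = e / 3 + e / 3 + e / 3); last by field.
by rewrite lerD// (le_trans (ler_normD _ _))// lerD.
Qed.

Lemma cvg_series_exp_coeff (a y : R) :
  series (fun n => a * exp_coeff y n) @ \oo --> a * expR y.
Proof.
have -> : series (fun n => a * exp_coeff y n) =
          (fun n => a * series (exp_coeff y) n).
  by apply/funext => n; rewrite /series /= mulr_sumr.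
by apply: cvgMr; exact: is_cvg_series_exp_coeff.
Qed.

End dominated_series.

(** This describes the integral operators of kernels of mass at most c through
    their action on functions alone. *)
Record bounded_operator (R : realType) (d : measure_display)
    (E : measurableType d) (T : (E -> R) -> E -> R) (c : R) : Prop := {
  operator_measurable : forall f, Bb f -> measurable_fun setT (T f) ;
  operator_le : forall f (M : R), Bb f -> (forall x, `|f x| <= M) ->
    forall x, `|T f x| <= c * M ;
  operator_daniell : forall x, daniell (fun f => T f x) }.

Definition operator_exp (R : realType) (E : Type) (T : (E -> R) -> E -> R)
    (t : R) (f : E -> R) (x : E) : R :=
  limn (series (fun n => t ^+ n / n`!%:R * iter n T f x)).

Section bounded_operator_theory.
Context (R : realType) (d : measure_display) (E : measurableType d).
Implicit Types (T S : (E -> R) -> E -> R) (f g : E -> R) (c : R).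

Lemma operator_Bb T c f : bounded_operator T c -> Bb f -> Bb (T f).
Proof.
move=> HT bf; apply: Bb_le; first exact: (operator_measurable HT bf).
by move=> x; apply: (operator_le HT bf (M := supnorm f)) => y; exact: supnorm_ub.
Qed.

Lemma bounded_operator_id : bounded_operator (id : (E -> R) -> _) 1.
Proof.
split=> [f []//|f M _ fM x|x]; first by rewrite mul1r.
by split=> // f_ f M _ _; exact.
Qed.

Lemma bounded_operator_comp T S c c' :
  bounded_operator T c -> bounded_operator S c' ->
  bounded_operator (fun f => T (S f)) (c * c').
Proof.
move=> HT HS; have SB f : Bb f -> Bb (S f) by exact: operator_Bb HS.
split=> [f bf|f M bf fM x|x].
- exact: (operator_measurable HT (SB _ bf)).
- by rewrite -mulrA; apply: (operator_le HT (SB _ bf)); exact: (operator_le HS bf fM).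
- split=> [f g bf bg|k f bf|f bf f0|f_ f M mf fM ff].
  + rewrite -(daniellD (operator_daniell HT x)); [|exact: SB..].
    congr (T _ x); apply/funext => y; by rewrite /= (daniellD (operator_daniell HS y)).
  + rewrite -(daniellZ (operator_daniell HT x)); last exact: SB.
    congr (T _ x); apply/funext => y; by rewrite /= (daniellZ (operator_daniell HS y)).
  + apply: (daniell_ge0 (operator_daniell HT x)); first exact: SB.
    by move=> y; exact: (daniell_ge0 (operator_daniell HS y)).
  + apply: (daniell_cvg (operator_daniell HT x) (M := c' * M)).
    * by move=> n; apply: (operator_measurable HS); exact: Bb_le (mf n) (fM n).
    * by move=> n y; apply: (operator_le HS) => //; exact: Bb_le (mf n) (fM n).
    * by move=> y; exact: (daniell_cvg (operator_daniell HS y) mf fM ff).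
Qed.

Lemma bounded_operator_iter T c n :
  bounded_operator T c -> bounded_operator (iter n T) (c ^+ n).
Proof.
move=> HT; elim: n => [|n IH]; first by rewrite expr0; exact: bounded_operator_id.
by rewrite exprS; exact: (bounded_operator_comp HT IH).
Qed.

Lemma act_daniell T c (mu : probability E R) :
  bounded_operator T c -> daniell (act mu T).
Proof.
move=> HT; have TB f : Bb f -> Bb (T f) by exact: operator_Bb HT.
have Hmu := Rintegral_daniell mu.
split=> [f g bf bg|k f bf|f bf f0|f_ f M mf fM ff]; rewrite /act.
- rewrite -(daniellD Hmu); [|exact: TB..].
  by apply: eq_Rintegral => x _; rewrite /= (daniellD (operator_daniell HT x)).
- rewrite -(daniellZ Hmu); last exact: TB.
  by apply: eq_Rintegral => x _; rewrite /= (daniellZ (operator_daniell HT x)).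
- by apply: Rintegral_ge0 => x _; exact: (daniell_ge0 (operator_daniell HT x)).
- apply: (daniell_cvg Hmu (M := c * M)) => [n|n x|x].
  + by apply: (operator_measurable HT); exact: Bb_le (mf n) (fM n).
  + by apply: (operator_le HT) => //; exact: Bb_le (mf n) (fM n).
  + exact: (daniell_cvg (operator_daniell HT x) mf fM ff).
Qed.

Section exponential.
Variables (T : (E -> R) -> E -> R) (c t : R).
Hypotheses (HT : bounded_operator T c) (t_ge0 : 0 <= t).

Let coeff f x n := t ^+ n / n`!%:R * iter n T f x.

Let coeff_le f (M : R) : Bb f -> (forall x, `|f x| <= M) ->
  forall x n, `|coeff f x n| <= M * exp_coeff (t * c) n.
Proof.
move=> bf fM x n; rewrite /coeff normrM ger0_norm ?divr_ge0 ?exprn_ge0//.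
have := operator_le (bounded_operator_iter n HT) bf fM x.
move=> /(ler_wpM2l _) => /(_ (t ^+ n / n`!%:R)).
rewrite divr_ge0 ?exprn_ge0// => /(_ isT) /le_trans; apply.
by rewrite /exp_coeff /= exprMn le_eqVlt; apply/orP; left; apply/eqP; ring.
Qed.

Lemma operator_exp_cvg f x : Bb f ->
  series (fun n => t ^+ n / n`!%:R * iter n T f x) @ \oo
    --> operator_exp T t f x.
Proof.
move=> bf; have fM y := supnorm_ub y bf.
have cb : cvgn (series (fun n => supnorm f * exp_coeff (t * c) n)).
  by apply/cvg_ex; eexists; exact: cvg_series_exp_coeff.
exact: (dominated_series (coeff_le bf fM x) cb).1.
Qed.

(** On functions bounded by M, the terms of the series are dominated by
    M (t c)^n / n!, whose sum is finite. *)
Lemma bounded_operator_exp :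
  bounded_operator (operator_exp T t) (expR (t * c)).
Proof.
have HTn n := bounded_operator_iter n HT.
split=> [f bf|f M bf fM x|x].
- have mS n : measurable_fun setT
      (fun x => series (fun k => t ^+ k / k`!%:R * iter k T f x) n).
    rewrite /series /=; apply: measurable_sum => i.
    by apply: measurable_funM => //; exact: (operator_measurable (HTn i) bf).
  by apply: (measurable_fun_cvg mS) => x _; exact: operator_exp_cvg.
- have cb : cvgn (series (fun n => M * exp_coeff (t * c) n)).
    by apply/cvg_ex; eexists; exact: cvg_series_exp_coeff.
  have := (dominated_series (coeff_le bf fM x) cb).2 0%N.
  have S0 (u : nat -> R) : series u 0%N = 0 by rewrite /series /= big_geq.
  by rewrite !S0 !subr0 (cvg_lim _ (@cvg_series_exp_coeff _ M (t * c)))// mulrC.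
- split=> [f g bf bg|k f bf|f bf f0|f_ f M mf fM ff].
  + apply: cvg_lim => //.
    rewrite (_ : series _ = series (coeff f x) \+ series (coeff g x)).
      by apply: cvgD; exact: operator_exp_cvg.
    apply/funext => n; rewrite /series /= -big_split /=.
    by apply: eq_bigr => i _; rewrite (daniellD (operator_daniell (HTn i) x))// mulrDr.
  + apply: cvg_lim => //.
    rewrite (_ : series _ = fun n => k * series (coeff f x) n).
      by apply: cvgMr; exact: operator_exp_cvg.
    apply/funext => n; rewrite /series /= mulr_sumr; apply: eq_bigr => i _.
    by rewrite (daniellZ (operator_daniell (HTn i) x))// mulrCA.
  + apply: limr_ge.
      by apply/cvg_ex; eexists; exact: operator_exp_cvg.
    apply: nearW => n; apply: sumr_ge0 => i _; rewrite mulr_ge0//.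
      by rewrite divr_ge0 ?exprn_ge0.
    exact: (daniell_ge0 (operator_daniell (HTn i) x)).
  + apply: (dominated_series_limit (b := fun n => M * exp_coeff (t * c) n)).
    * by move=> n k; apply: coeff_le => //; exact: Bb_le (mf n) (fM n).
    * by apply/cvg_ex; eexists; exact: cvg_series_exp_coeff.
    * move=> k; apply: cvgMr.
      exact: (daniell_cvg (operator_daniell (HTn k) x) mf fM ff).
Qed.

End exponential.
End bounded_operator_theory.

(** * Integrals over positive times *)
Section exponential_integrals.
Context (R : realType).
Notation leb := (@lebesgue_measure R).
Notation D := (`]0%R, +oo[%classic : set R).

Lemma half_line_gt0 (s : R) : s \in D -> 0 < s.
Proof. by rewrite inE/= in_itv/= andbT. Qed.

Lemma integral_expR_half_line (a : R) : 0 < a ->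
  (\int[leb]_(s in D) (expR (- a * s))%:E = a^-1%:E)%E.
Proof.
move=> a0.
have mexp (A : set R) : measurable_fun A (fun s : R => expR (- a * s)).
  apply: measurable_funTS; apply: (measurableT_comp (@measurable_expR R)).
  exact: measurable_funM.
rewrite integral_itv_obnd_cbnd; last exact/measurable_EFinP.
rewrite integral_mkcond -[RHS]mule1 -(integral_exponential_pdf a0).
rewrite -ge0_integralZl_EFin ?invr_ge0 ?ltW//; last 2 first.
- by move=> x _; rewrite lee_fin exponential_pdf_ge0// ltW.
- by apply/measurable_EFinP; exact: measurable_exponential_pdf.
apply: eq_integral => x _; rewrite /exponential_pdf !patchE.
by case: ifP => _; rewrite -EFinM ?mulr0// mulKf ?gt_eqF.
Qed.

Lemma integrable_expR_half_line (a : R) : 0 < a ->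
  leb.-integrable D (fun s => (expR (- a * s))%:E).
Proof.
move=> a0; apply/integrableP; split.
  apply/measurable_EFinP; apply: measurable_funTS.
  by apply: (measurableT_comp (@measurable_expR R)); exact: measurable_funM.
under eq_integral do rewrite gee0_abs ?lee_fin ?expR_ge0//.
by rewrite integral_expR_half_line// ltry.
Qed.

(** The step that divides by the rates: the integrals of e^(-lambda r) and
    e^(-kappa r) over r > 0 are 1 / lambda and 1 / kappa, and the countable set
    N of exceptional times is null. *)
Lemma Rintegral_expR_estimate (h : R -> R) (N : set R) (a K lambda kappa : R) :
  0 < lambda -> 0 < kappa -> 0 <= K ->
  leb.-integrable D (EFin \o h) -> countable N ->
  (forall r, 0 < r -> ~ N r ->
    `|h r - a * expR (- lambda * r)| <= K * expR (- kappa * r)) ->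
  `|Rintegral leb D h - a / lambda| <= K / kappa.
Proof.
move=> l0 k0 K0 ih cN hN.
have ie (c : R) a' : 0 < a' -> leb.-integrable D (EFin \o (fun r => c * expR (- a' * r))).
  move=> a'0; rewrite (_ : _ \o _ = fun r => (c%:E * (expR (- a' * r))%:E)%E)//.
  by apply: integrableZl => //; exact: integrable_expR_half_line.
have Ie (c : R) a' : 0 < a' -> Rintegral leb D (fun r => c * expR (- a' * r)) = c / a'.
  move=> a'0; rewrite RintegralZl//; last exact: integrable_expR_half_line.
  by rewrite /Rintegral integral_expR_half_line.
rewrite -(Ie _ _ l0) -RintegralB//; last exact: ie.
have iB : leb.-integrable D (EFin \o (fun r => h r - a * expR (- lambda * r))).
  rewrite (_ : _ \o _ = (fun r => ((h r)%:E - (a * expR (- lambda * r))%:E)%E))//.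
  by apply: integrableB => //; exact: ie.
rewrite (le_trans (le_normr_Rintegral _ iB))// -(Ie _ _ k0).
rewrite /Rintegral fine_le//.
- exact: (integrable_fin_num _ (integrable_norm iB)).
- exact: (integrable_fin_num _ (ie _ _ k0)).
- apply: ae_ge0_le_integral => //.
  + by have /integrableP[mB _] := integrable_norm iB.
  + by move=> r _; rewrite lee_fin mulr_ge0 ?expR_ge0.
  + by have /integrableP[] := ie K _ k0.
  + exists N; split; [exact: countable_measurable|exact: countable_lebesgue_measure0|].
    move=> r /= /not_implyP[]; rewrite in_itv/= andbT => r0 hr.
    by apply: contrapT => Nr; apply: hr; rewrite lee_fin hN.
Qed.
End exponential_integrals.

Section time_fubini.
Context (R : realType) (d : measure_display) (Omega : measurableType d).
Notation D := (`]0%R, +oo[%classic : set R).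

(** Fubini's theorem for the expectation of a time integral. Integrability over
    the product is obtained by taking expectations first, since it is the
    expectation at a given time that b controls. Extending F by 0 to nonpositive
    times keeps the product space equal to all of Omega x R. *)
Lemma integral_time_swap (m : probability Omega R)
    (F : Omega * measurableTypeR R -> R) (b : R -> R) (M : R) :
  measurable_fun setT F ->
  (forall w s, s <= 0 -> F (w, s) = 0) ->
  (forall z, `|F z| <= M) ->
  (@lebesgue_measure R).-integrable D (EFin \o b) ->
  (forall s, 0 < s -> Rintegral m setT (fun w => `|F (w, s)|) <= b s) ->
  let G s := Rintegral m setT (fun w => F (w, s)) in
  (@lebesgue_measure R).-integrable D (EFin \o G) /\
  (\int[m]_w \int[lebesgue_measure]_(s in D) (F (w, s))%:E =
   (Rintegral lebesgue_measure D G)%:E)%E.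
Proof.
move=> mF F0 FM ib Fb G.
have FB s : Bb (fun w => F (w, s)).
  apply: (@Bb_le _ _ _ _ M) => [|w]; last exact: FM.
  by apply: (measurableT_comp mF); exact: measurable_pair2.
have FB' s : Bb (fun w => `|F (w, s)|).
  apply: (@Bb_le _ _ _ _ M) => [|w]; last by rewrite normr_id.
  by apply: measurableT_comp => //; case: (FB s).
have GE s : (\int[m]_w (F (w, s))%:E = (G s)%:E)%E by exact: Bb_RintegralE.
pose leb : {sigma_finite_measure set (measurableTypeR R) -> \bar R} := lebesgue_measure.
have mFE : measurable_fun setT (EFin \o F) by exact/measurable_EFinP.
have iF : (m \x leb)%E.-integrable setT (EFin \o F).
  apply/(integrable21ltyP _ _ mFE).
  rewrite (_ : integral _ _ _ = (\int[leb]_(s in D)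
      (Rintegral m setT (fun w => `|F (w, s)|))%:E)%E); last first.
    rewrite [RHS]integral_mkcond; apply: eq_integral => s _.
    rewrite patchE; case: ifPn => [|/negP].
      rewrite inE/= in_itv/= andbT => s0.
      rewrite /Rintegral fineK//.
      exact: (integrable_fin_num measurableT (Bb_integrable m (FB' s))).
    move=> sD; have s0 : s <= 0.
      by rewrite leNgt; apply/negP => s0; apply: sD; rewrite inE/= in_itv/= s0.
    by rewrite integral0_eq// => w _; rewrite /= F0// normr0.
  have /integrableP[mb bfin] := ib.
  apply: le_lt_trans bfin; apply: ge0_le_integral => //.
  - by move=> s _; rewrite lee_fin Rintegral_ge0.
  - apply: measurable_funTS.
    have mF' : measurable_fun setT (fun z => `|F z|%:E).
      by apply/measurable_EFinP; exact: measurableT_comp.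
    have : measurable_fun setT (fubini_G m (fun z => `|F z|%:E)).
      by apply: measurable_fun_fubini_tonelli_G.
    congr measurable_fun; apply/funext => s; rewrite /fubini_G.
    rewrite /Rintegral fineK//.
    exact: (integrable_fin_num measurableT (Bb_integrable m (FB' s))).
  - exact: measurableT_comp.
  - move=> s; rewrite /= in_itv/= andbT => s0.
    by rewrite lee_fin (le_trans (Fb _ s0))// ler_norm.
have F0D (s : R) : s \notin D -> s <= 0.
  move=> /negP sD; rewrite leNgt; apply/negP => s0; apply: sD.
  by rewrite inE/= in_itv/= s0.
have GD (s : R) : s \notin D -> G s = 0.
  move=> /F0D s0; rewrite /G /Rintegral integral0_eq// => w _.
  by rewrite F0.
have mG : measurable_fun setT (EFin \o G).
  have := measurable_fubini_G iF; congr measurable_fun.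
  by apply/funext => s; rewrite /fubini_G GE.
have iG : (@lebesgue_measure R).-integrable D (EFin \o G).
  apply: le_integrable ib => //; first exact: measurable_funTS.
  move=> s; rewrite /= in_itv/= andbT => s0.
  rewrite lee_fin (le_trans (le_normr_Rintegral _ _))//; first exact: Bb_integrable.
  by rewrite (le_trans (Fb _ s0))// ler_norm.
split=> //; transitivity (\int[m]_w \int[leb]_s (F (w, s))%:E)%E.
  apply: eq_integral => w _; rewrite integral_mkcond; apply: eq_integral => s _.
  rewrite patchE; case: ifPn => // /F0D s0.
  by rewrite F0.
rewrite (Fubini iF); under eq_integral do rewrite /= GE.
rewrite /Rintegral fineK; last exact: integrable_fin_num iG.
rewrite [RHS]integral_mkcond; apply: eq_integral => s _.
by rewrite patchE; case: ifPn => // /GD ->.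
Qed.

End time_fubini.

(** * The transition operators *)
Section path_law.
Context (R : realType) (d dO : measure_display)
  (E : measurableType d) (Omega : measurableType dO).
Variable P : R.-pker (option E) ~> Omega.

(** A name for the measure P y to which a probability structure can be
    attached. *)
Definition path_law (y : option E) : set Omega -> \bar R := P y.
HB.instance Definition _ y := Measure.on (path_law y).
HB.instance Definition _ y :=
  Measure_isProbability.Build _ _ _ (path_law y) (prob_kernel y).

(** A kernel that ignores its time argument: integrating against it a function
    of time and path yields a function that is measurable jointly in the time
    and in the starting point. *)
Definition timed_law (z : option E * measurableTypeR R) : {measure set Omega -> \bar R} :=
  P z.1.

Let measurable_timed_law U : measurable U ->
  measurable_fun setT (fun z => timed_law z U).
Proof.
move=> mU; apply: (measurableT_comp (measurable_kernel P U mU)).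
exact: measurable_fst.
Qed.
HB.instance Definition _ :=
  isKernel.Build _ _ _ _ R timed_law measurable_timed_law.

Let timed_law1 z : timed_law z setT = 1%E.
Proof. exact: prob_kernel. Qed.
HB.instance Definition _ :=
  Kernel_isProbability.Build _ _ _ _ R timed_law timed_law1.
End path_law.

Section extension.
Context (R : realType) (d : measure_display) (E : measurableType d).

(** The value 0 at the cemetery encodes killing: evaluated along X, the
    extension vanishes as soon as the process is dead. *)
Definition extend (f : E -> R) : option E -> R := fun y => oapp f 0 y.

Lemma extend_Bb (f : E -> R) : Bb f -> Bb (extend f).
Proof.
move=> bf; apply: (@Bb_le _ _ _ _ (supnorm f + `|supnorm f|)) => [|[x|]].
- move=> _ Y mY; rewrite setTI; rewrite /measurable /= /cemetery_measurable /=.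
  have -> : Some @^-1` (extend f @^-1` Y) = f @^-1` Y by [].
  by rewrite -(setTI (f @^-1` Y)); case: bf => mf _; exact: mf.
- by rewrite /= (le_trans (supnorm_ub x bf))// lerDl.
- by rewrite /= normr0 addrC -lerBlDr sub0r -normrN ler_norm.
Qed.

Lemma measurable_Some (B : set E) : measurable B -> measurable (Some @` B).
Proof.
move=> mB; rewrite /measurable /= /cemetery_measurable /=.
rewrite (_ : _ @^-1` _ = B)//; apply/seteqP; split=> [x [y By [<-]]//|x Bx].
by exists x.
Qed.
Lemma measurable_None : measurable [set None : option E].
Proof.
rewrite /measurable /= /cemetery_measurable /= (_ : _ @^-1` _ = set0)//.
by apply/seteqP; split.
Qed.
End extension.

Section transition.
Context (R : realType) (d dO : measure_display)
  (E : measurableType d) (Omega : measurableType dO).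
Variables (X : R -> Omega -> option E) (P : R.-pker (option E) ~> Omega).
Hypotheses (X_markov : markov_process X P) (X_absorbing : absorbing X).

(** The semigroup of X on the whole of E and the cemetery. Applied to extended
    functions it kills on X_s = None, not on tau <= s: for that convention the
    semigroup property is the Markov property itself. *)
Definition transition (s : R) (g : option E -> R) (y : option E) : R :=
  Rintegral (path_law P y) setT (fun w => g (X s w)).

Lemma measurable_time_set :
  measurable [set p : measurableTypeR R * Omega | 0 <= p.1].
Proof.
rewrite (_ : [set p | _] = (@fst (measurableTypeR R) Omega) @^-1` `[0, +oo[).
  by rewrite -[X in measurable X]setTI; exact: measurable_fst.
by apply/seteqP; split=> p /=; rewrite in_itv/= andbT.
Qed.

Lemma measurable_X s : 0 <= s -> measurable_fun setT (X s).
Proof.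
move=> s0 _ Y mY; rewrite setTI.
have := markov_measurable X_markov measurable_time_set mY.
move=> /(measurable_xsection s); congr measurable.
by apply/seteqP; split=> w; rewrite /xsection /= inE//= => -[].
Qed.

Lemma measurable_path w :
  measurable_fun (`[0, +oo[%classic : set (measurableTypeR R)) (fun s => X s w).
Proof.
move=> _ Y mY.
have := markov_measurable X_markov measurable_time_set mY.
move=> /(measurable_ysection w); congr measurable.
by apply/seteqP; split=> s; rewrite /ysection /= inE/= in_itv/= andbT.
Qed.

(** Negative times are cut off because X is arbitrary there, and time 0 because
    the time integrals below run over positive times. *)
Definition path_value (g : option E -> R) : Omega * measurableTypeR R -> R :=
  (fun z => g (X z.2 z.1)) \_ [set z | 0 < z.2].

Lemma measurable_positive_time :
  measurable [set z : Omega * measurableTypeR R | 0 < z.2].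
Proof.
rewrite (_ : [set z | _] = (@snd Omega (measurableTypeR R)) @^-1` `]0, +oo[).
  by rewrite -[X in measurable X]setTI; exact: measurable_snd.
by apply/seteqP; split=> p /=; rewrite in_itv/= andbT.
Qed.

Lemma measurable_path_value g : measurable_fun setT g ->
  measurable_fun setT (path_value g).
Proof.
move=> mg; apply/(measurable_restrictT _ measurable_positive_time).
apply: (measurableT_comp mg).
apply: (measurable_comp measurable_time_set _ (markov_measurable X_markov)
  (g := fun z : Omega * measurableTypeR R => (z.2, z.1))).
  by move=> _ [z /= z0 <-] /=; exact: ltW.
by apply: measurable_funTS; exact: measurable_swap.
Qed.

Lemma path_value_time (g : option E -> R) w (s : R) : 0 < s ->
  path_value g (w, s) = g (X s w).
Proof. by move=> s0; rewrite /path_value patchE ifT// inE. Qed.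

Lemma path_value_le (g : option E -> R) (M : R) z :
  (forall y, `|g y| <= M) -> `|path_value g z| <= M.
Proof.
move=> gM; rewrite /path_value patchE; case: ifP => // _.
by rewrite normr0 (le_trans _ (gM None)).
Qed.

Lemma path_value_Bb g s : Bb g -> Bb (fun w => path_value g (w, s)).
Proof.
move=> bg; apply: (@Bb_le _ _ _ _ (supnorm g)) => [|w].
  apply: (measurableT_comp (measurable_path_value (proj1 bg))).
  exact: measurable_pair2.
by apply: path_value_le => y; exact: supnorm_ub.
Qed.

(** Integration against a kernel preserves measurability of nonnegative
    functions; a bounded g is a difference of two such functions. *)
Lemma measurable_transition g : Bb g ->
  measurable_fun setT (fun z : option E * measurableTypeR R =>
    Rintegral (path_law P z.1) setT (fun w => path_value g (w, z.2))).
Proof.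
move=> bg; have pos h : Bb h -> (forall y, 0 <= h y) ->
    measurable_fun setT (fun z : option E * measurableTypeR R =>
      Rintegral (path_law P z.1) setT (fun w => path_value h (w, z.2))).
  move=> bh h0; apply: (measurableT_comp (fine_measurable measurableT)).
  apply: (measurable_fun_integral_finite_kernel
    (fun u : (option E * measurableTypeR R) * Omega =>
       (path_value h (u.2, u.1.2))%:E) (timed_law P)).
    move=> u; rewrite lee_fin /path_value patchE; case: ifP => // _; exact: h0.
  apply/measurable_EFinP; apply: (measurableT_comp (measurable_path_value (proj1 bh))).
  apply: measurable_fun_pair; first exact: measurable_snd.
  by apply: (measurableT_comp measurable_snd); exact: measurable_fst.
have bM : Bb (cst (supnorm g) : option E -> R) by exact: Bb_cst.
rewrite (_ : (fun z => _) = (fun z : option E * measurableTypeR R =>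
   Rintegral (path_law P z.1) setT (fun w => path_value (g \+ cst (supnorm g)) (w, z.2))
   - Rintegral (path_law P z.1) setT (fun w => path_value (cst (supnorm g)) (w, z.2)))).
  apply: measurable_funB; last by apply: pos => // y; exact: supnorm_ge0 None bg.
  by apply: pos => [|y]; [exact: Bb_add|exact: Bb_shift_ge0].
apply/funext => z; rewrite -RintegralB//; last 2 first.
- by apply: Bb_integrable; apply: path_value_Bb; exact: Bb_add.
- by apply: Bb_integrable; exact: path_value_Bb.
apply: eq_Rintegral => w _; rewrite /path_value !patchE.
by case: ifP => _; rewrite ?subr0//= addrK.
Qed.

Lemma Bb_comp_X (s : R) (g : option E -> R) : 0 <= s -> Bb g -> Bb (g \o X s).
Proof.
move=> s0 bg; apply: (@Bb_le _ _ _ _ (supnorm g)) => [|w].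
  by apply: measurableT_comp (measurable_X s0); case: bg.
exact: (supnorm_ub (X s w) bg).
Qed.

Lemma transition_operator (s : R) : 0 < s -> bounded_operator (transition s) 1.
Proof.
move=> s0; have XB (g : option E -> R) : Bb g -> Bb (g \o X s) by exact/Bb_comp_X/ltW.
have D y := Rintegral_daniell (path_law P y).
have Dy y : daniell (transition s ^~ y).
  split=> [f g bf bg|k f bf|f bf f0|f_ f M mf fM ff]; rewrite /transition.
  - by rewrite -(daniellD (D y))//; exact: XB.
  - by rewrite -(daniellZ (D y))//; exact: XB.
  - by apply: Rintegral_ge0.
  - apply: (daniell_cvg (D y) (M := M)) => [n|//|w]; last exact: ff.
    exact: measurableT_comp (mf n) (measurable_X (ltW s0)).
split=> [f bf|f M bf fM y|//].
- rewrite (_ : transition s f = (fun z : option E * measurableTypeR R =>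
    Rintegral (path_law P z.1) setT (fun w => path_value f (w, z.2))) \o (pair ^~ s)).
    apply: (measurableT_comp (measurable_transition bf)).
    exact: measurable_pair2.
  apply/funext => y /=; apply: eq_Rintegral => w _.
  by rewrite path_value_time.
- have := daniell_norm (Dy y) (proj1 bf) fM.
  rewrite /transition (_ : (fun w => cst 1 (X s w)) = cst 1)//.
  by rewrite probability_Rintegral1 mulr1 mul1r.
Qed.

Lemma transition_indic (B : set (option E)) s y : 0 < s -> measurable B ->
  (transition s \1_B y)%:E = P y (X s @^-1` B).
Proof.
move=> s0 mB; rewrite /transition /Rintegral.
rewrite (_ : (fun w => _) = (fun w => (\1_(X s @^-1` B) w)%:E))//.
have mXB : measurable (X s @^-1` B).
  by rewrite -[X in measurable X]setTI; exact: (measurable_X (ltW s0)).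
rewrite integral_indic// setIT fineK//.
by exact: (fin_num_measure (path_law P y)).
Qed.

(** Both sides are Daniell functionals of g, so they need only be compared on
    indicators, where the claim is the Markov property for events. *)
Lemma transition_semigroup g s t y : 0 < s -> 0 < t -> Bb g ->
  transition (s + t) g y = transition s (transition t g) y.
Proof.
move=> s0 t0 bg; have st0 : 0 < s + t by exact: addr_gt0.
have H1 := operator_daniell (transition_operator st0) y.
have H2 := operator_daniell (bounded_operator_comp (transition_operator s0)
  (transition_operator t0)) y.
apply: (daniell_unique H1 H2 _ bg) => B mB; apply: EFin_inj.
rewrite transition_indic//.
have pT : past X s setT.
  apply: sub_sigma_algebra; exists 0, setT; split; [|exact: measurableT|by []].
  by rewrite lexx ltW.
have := markov_property X_markov y (ltW s0) (ltW t0) pT mB; rewrite setTI => ->.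
have bh := operator_Bb (transition_operator t0) (Bb_indic R mB).
rewrite [in RHS]/transition /Rintegral fineK; last first.
  exact: (integrable_fin_num measurableT
    (Bb_integrable (path_law P y) (Bb_comp_X (ltW s0) bh))).
by apply: eq_integral => w _; rewrite -transition_indic.
Qed.

(** A path started at the cemetery is there at time 0, hence for ever. *)
Lemma transition_None g s : 0 < s -> Bb g -> g None = 0 ->
  transition s g None = 0.
Proof.
move=> s0 bg gN; rewrite /transition /Rintegral.
have mN : measurable (X 0 @^-1` [set None]).
  rewrite -[X in measurable X]setTI; apply: measurable_X => //.
  exact: measurable_None.
have P1 : path_law P None (X 0 @^-1` [set None]) = 1%E.
  rewrite /path_law (markov_start X_markov); last exact: measurable_None.
  by rewrite diracE mem_set.
have P0 : path_law P None (~` (X 0 @^-1` [set None])) = 0%E.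
  by rewrite [LHS](probability_setC (path_law P None) mN) [X in (1 - X)%E]P1 subee.
rewrite (@ae_eq_integral _ _ _ (path_law P None) setT (cst 0%E))//.
- by rewrite integral0.
- by apply/measurable_EFinP; case: (Bb_comp_X (ltW s0) bg).
exists (~` (X 0 @^-1` [set None])); split => //; first exact: measurableC.
apply: subsetC => w /= X0 _.
by rewrite (@X_absorbing 0 s w)// ?gN// ltW.
Qed.

Lemma transition_extend_daniell (s : R) y : 0 < s ->
  daniell (fun f : E -> R => transition s (extend f) y).
Proof.
move=> s0; have H := operator_daniell (transition_operator s0) y.
split=> [f g bf bg|k f bf|f bf f0|f_ f M mf fM ff].
- rewrite -(daniellD H); [|exact: extend_Bb..].
  by congr transition; apply/funext => -[z|]//=; rewrite addr0.
- rewrite -(daniellZ H); last exact: extend_Bb.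
  by congr transition; apply/funext => -[z|]//=; rewrite mulr0.
- by apply: (daniell_ge0 H); [exact: extend_Bb|case].
- apply: (daniell_cvg H (M := `|M|)) => [n|n [z|]|[z|]] //=.
  + by case: (extend_Bb (Bb_le (mf n) (fM n))).
  + exact: le_trans (fM n z) (ler_norm M).
  + by rewrite normr0.
  + exact: cvg_cst.
Qed.
Notation D := (`]0%R, +oo[%classic : set R).
(** * The Green operator as a time integral of transition operators *)
Lemma tau_lt w (s : R) : (tau X w < s%:E)%E -> X s w = None.
Proof.
move=> /ereal_inf_lt[_ [t [t0 Xt] <-]]; rewrite lte_fin => ts.
exact: (X_absorbing t0 (ltW ts) Xt).
Qed.

Lemma tau_le w (s : R) : 0 <= s -> X s w = None -> (tau X w <= s%:E)%E.
Proof. by move=> s0 Xs; apply: ereal_inf_lbound; exists s. Qed.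

(** Before tau the process is in E and after tau it is dead, so the two
    integrands, extended by 0, differ at most at the times 0 and tau. *)
Lemma integral_lifetime (f : E -> R) w : Bb f ->
  (\int[lebesgue_measure]_(s in [set s : R | (0 <= s)%R /\ s%:E < tau X w])
     (oapp f 0%R (X s w))%:E =
   \int[lebesgue_measure]_(s in D) (extend f (X s w))%:E)%E.
Proof.
move=> bf; set T := [set s : R | _].
have mtau : measurable ([set s : R | (s%:E < tau X w)%E] : set (measurableTypeR R)).
  case: (tau X w) => [r| |].
  - by rewrite (_ : [set s | _] = `]-oo, r[%classic).
  - rewrite (_ : [set s | _] = setT)//.
    by apply/seteqP; split=> s //= _; rewrite ltry.
  - rewrite (_ : [set s | _] = set0)//.
    by apply/seteqP; split=> s //=.
have mT : measurable (T : set (measurableTypeR R)).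
  rewrite (_ : T = `[0, +oo[%classic `&` [set s : R | (s%:E < tau X w)%E]).
    exact: measurableI.
  by apply/seteqP; split=> s /=; rewrite in_itv/= andbT.
have mfX : measurable_fun (`[0, +oo[%classic : set (measurableTypeR R))
    (fun s => (extend f (X s w))%:E).
  apply/measurable_EFinP.
  by apply: (measurableT_comp (proj1 (extend_Bb bf))); exact: measurable_path.
have TD : T `<=` `[0, +oo[ by move=> s [s0 _]; rewrite /= in_itv/= s0.
have DD : D `<=` `[0, +oo[.
  by move=> s; rewrite /= !in_itv/= !andbT; exact: ltW.
rewrite integral_mkcond [RHS]integral_mkcond.
apply: ae_eq_integral => //.
- apply/(measurable_restrictT _ mT); exact: measurable_funS TD mfX.
- apply/(measurable_restrictT _ (measurable_itv _)); exact: measurable_funS DD mfX.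
exists [set 0; fine (tau X w)]; split.
- exact: measurableU.
- by apply: countable_lebesgue_measure0; exact/finite_set_countable/finite_set2.
move=> s /= /not_implyP[_ sTD]; apply: contrapT => /not_orP[s0 st]; apply: sTD.
rewrite !patchE; case: ifPn => sT; case: ifPn => sD //.
- exfalso; move/negP: sD; apply; move: sT; rewrite !inE /= in_itv/= andbT => -[].
  by rewrite le_eqVlt => /predU1P[/esym|].
- move: sD; rewrite inE/= in_itv/= andbT => sgt0.
  suff -> : X s w = None by [].
  apply: tau_lt; rewrite lt_neqAle; apply/andP; split.
    by apply/negP => /eqP ts; apply: st; rewrite ts.
  rewrite leNgt; apply/negP => st'; move/negP: sT; apply.
  by rewrite inE; split=> //; exact: ltW.
Qed.

Section green.
Variables (c lambda : R).
Hypotheses (lambda_gt0 : 0 < lambda) (c_ge0 : 0 <= c)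
  (survival : forall s x, 0 < s ->
     transition s (extend (cst 1)) (Some x) <= c * expR (- lambda * s)).

Lemma survival_extend (f : E -> R) (M : R) s y :
  Bb f -> 0 <= M -> (forall x, `|f x| <= M) -> 0 < s ->
  Rintegral (path_law P y) setT (fun w => `|extend f (X s w)|)
    <= M * c * expR (- lambda * s).
Proof.
move=> bf M0 fM s0.
have b1 : Bb (extend (cst 1 : E -> R)) by exact/extend_Bb/Bb_cst.
have iM : Bb (fun w => M * extend (cst 1) (X s w)).
  by apply: Bb_scale; exact: Bb_comp_X (ltW s0) b1.
apply: (@le_trans _ _ (Rintegral (path_law P y) setT
    (fun w => M * extend (cst 1) (X s w)))).
  apply: le_Rintegral => //.
  - apply: (Bb_integrable _ (f := fun w => `|extend f (X s w)|)).
    have bfX := Bb_comp_X (ltW s0) (extend_Bb bf).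
    apply: (@Bb_le _ _ _ _ (supnorm (extend f \o X s))).
      by apply: measurableT_comp => //; case: bfX.
    by move=> w; rewrite normr_id; exact: (supnorm_ub w bfX).
  - exact: Bb_integrable iM.
  - move=> w _; case: (X s w) => [x|] /=; first by rewrite mulr1.
    by rewrite normr0 mulr0.
rewrite RintegralZl//; last exact: Bb_integrable (Bb_comp_X (ltW s0) b1).
rewrite -mulrA -/(transition s (extend (cst 1)) y).
case: y => [x|]; last first.
  by rewrite transition_None// mulr0 !mulr_ge0// expR_ge0.
by rewrite ler_wpM2l ?survival.
Qed.

Lemma transition_extend_le (f : E -> R) (M : R) s y :
  Bb f -> 0 <= M -> (forall x, `|f x| <= M) -> 0 < s ->
  `|transition s (extend f) y| <= M * c * expR (- lambda * s).
Proof.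
move=> bf M0 fM s0; apply: le_trans (survival_extend y bf M0 fM s0).
apply: le_normr_Rintegral => //.
exact: Bb_integrable (Bb_comp_X (ltW s0) (extend_Bb bf)).
Qed.

Let integrable_bound (M : R) :
  (@lebesgue_measure R).-integrable D
    (EFin \o (fun s => M * c * expR (- lambda * s))).
Proof.
rewrite (_ : _ \o _ = fun s => ((M * c)%:E * (expR (- lambda * s))%:E)%E)//.
by apply: integrableZl => //; exact: integrable_expR_half_line.
Qed.

(** The lifetime integral is an integral over all positive times, to which
    Fubini's theorem applies because survival decays exponentially. *)
Lemma green_transition (f : E -> R) x : Bb f ->
  (@lebesgue_measure R).-integrable D
    (EFin \o (fun r => transition r (extend f) (Some x))) /\
  green X P f x =
    Rintegral (@lebesgue_measure R) D (fun r => transition r (extend f) (Some x)).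
Proof.
move=> bf; have fM y := supnorm_ub y bf; have bh := extend_Bb bf.
pose F := path_value (extend f).
have [|||||iG E1] := integral_time_swap
  (m := path_law P (Some x)) (F := F)
  (b := fun s => supnorm f * c * expR (- lambda * s)) (M := supnorm (extend f)).
- exact: measurable_path_value (proj1 bh).
- by move=> w s s0; rewrite /F /path_value patchE memNset//= ltNge s0.
- by move=> z; apply: path_value_le => y; exact: supnorm_ub.
- exact: integrable_bound.
- move=> s s0; under eq_Rintegral do rewrite /F path_value_time//.
  exact: survival_extend (supnorm_ge0 x bf) fM s0.
have GE s : 0 < s -> Rintegral (path_law P (Some x)) setT (fun w => F (w, s)) =
    transition s (extend f) (Some x).
  by move=> s0; apply: eq_Rintegral => w _; rewrite /F path_value_time.
have DE := @half_line_gt0 R.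
split.
  move: iG; apply: eq_integrable => // s /DE s0.
  by rewrite /= GE.
transitivity (fine (\int[path_law P (Some x)]_w
    \int[lebesgue_measure]_(s in D) (F (w, s))%:E)%E).
  congr fine; apply: eq_integral => w _; rewrite integral_lifetime//.
  by apply: eq_integral => s /DE s0; rewrite /F path_value_time.
by rewrite E1; apply: eq_Rintegral => s /DE s0; rewrite GE.
Qed.

Lemma green_le (f : E -> R) (M : R) x : Bb f -> (forall x, `|f x| <= M) ->
  `|green X P f x| <= c / lambda * M.
Proof.
move=> bf fM; have [iQ ->] := green_transition x bf.
have M0 : 0 <= M by exact: le_trans (fM x).
have : `|Rintegral (@lebesgue_measure R) D (fun r => transition r (extend f) (Some x))
    - 0 / lambda| <= M * c / lambda.
  apply: (Rintegral_expR_estimate (N := set0)) => //; first exact: mulr_ge0.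
  by move=> r r0 _; rewrite mul0r subr0; exact: transition_extend_le.
by rewrite mul0r subr0 [c / lambda * M]mulrC mulrA.
Qed.

Lemma green_daniell x : daniell (fun f => green X P f x).
Proof.
have iG f : Bb f -> (@lebesgue_measure R).-integrable D
    (EFin \o (fun r => transition r (extend f) (Some x))).
  by move=> bf; case: (green_transition x bf).
have Tr r : 0 < r -> daniell (fun f => transition r (extend f) (Some x)).
  exact: transition_extend_daniell.
have DE := @half_line_gt0 R.
split=> [f g bf bg|k f bf|f bf f0|f_ f M mf fM ff].
- rewrite !(green_transition x _).2//; last exact: Bb_add.
  rewrite -RintegralD//; [|exact: iG..].
  by apply: eq_Rintegral => r /DE r0; rewrite (daniellD (Tr _ r0)).
- rewrite !(green_transition x _).2//; last exact: Bb_scale.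
  rewrite -RintegralZl//; last exact: iG.
  by apply: eq_Rintegral => r /DE r0; rewrite (daniellZ (Tr _ r0)).
- rewrite (green_transition x bf).2; apply: Rintegral_ge0 => r Dr.
  by apply: (daniell_ge0 (Tr _ (DE _ _))) => //; rewrite inE.
- have M0 : 0 <= M by exact: le_trans (fM 0%N x).
  have bf_ n : Bb (f_ n) by exact: Bb_le (mf n) (fM n).
  have bf : Bb f.
    apply: (@Bb_le _ _ _ _ M); first by apply: (measurable_fun_cvg mf) => y _; exact: ff.
    move=> y; apply: (ler_cvg_to (cvg_norm (ff y)) (@cvg_cst _ M _ _ _)).
    exact: nearW.
  rewrite (green_transition x bf).2; under eq_fun do rewrite (green_transition x (bf_ _)).2.
  apply: (Rintegral_dominated_cvg (m := @lebesgue_measure R) (A := D)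
    (f_ := fun n r => transition r (extend (f_ n)) (Some x))
    (f := fun r => transition r (extend f) (Some x))
    (g := fun s => M * c * expR (- lambda * s)) (measurable_itv _)).
  + by move=> n; apply/measurable_EFinP; case/integrableP: (iG _ (bf_ n)).
  + by apply/measurable_EFinP; case/integrableP: (iG _ bf).
  + move=> r /mem_set /DE r0; exact: (daniell_cvg (Tr _ r0) mf fM ff).
  + exact: integrable_bound.
  + move=> n r /mem_set /DE r0; exact: transition_extend_le.
Qed.

Lemma measurable_green f : Bb f -> measurable_fun setT (green X P f).
Proof.
move=> bf; have [[x0 _]|nE] := pselect (exists x : E, True); last first.
  move=> _ Y _; rewrite setTI (_ : _ @^-1` _ = set0)//.
  by rewrite -subset0 => x _; apply: nE; exists x.
have DE := @half_line_gt0 R.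
have pos g : Bb g -> (forall x, 0 <= g x) -> measurable_fun setT (green X P g).
  move=> bg g0.
  pose J (z : E * measurableTypeR R) := Rintegral (path_law P (Some z.1)) setT
    (fun w => path_value (extend g) (w, z.2)).
  have mJ : measurable_fun setT (EFin \o J).
    apply/measurable_EFinP.
    apply: (measurableT_comp (measurable_transition (extend_Bb bg))
      (g := fun z : E * measurableTypeR R => (Some z.1, z.2))).
    apply: measurable_fun_pair; last exact: measurable_snd.
    apply: (measurableT_comp _ measurable_fst).
    by move=> _ Y mY; rewrite setTI.
  have J0 z : (0 <= (EFin \o J) z)%E.
    rewrite lee_fin; apply: Rintegral_ge0 => w _; rewrite /path_value patchE.
    by case: ifP => // _; case: (X _ _) => //=.
  pose leb : {sigma_finite_measure set (measurableTypeR R) -> \bar R} := lebesgue_measure.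
  have : measurable_fun setT (fubini_F leb (EFin \o J)).
    exact: measurable_fun_fubini_tonelli_F.
  move=> /(measurableT_comp (fine_measurable measurableT)).
  congr measurable_fun; apply/funext => x; rewrite (green_transition x bg).2.
  rewrite /= /Rintegral [in RHS]integral_mkcond; congr fine.
  apply: eq_integral => s _; rewrite patchE /=; case: ifPn => [/DE s0|/negP sD].
    congr EFin; apply: eq_Rintegral => w _; by rewrite path_value_time.
  congr EFin; rewrite /J /Rintegral integral0_eq// => w _ /=.
  rewrite /path_value patchE memNset//= => s0; apply: sD.
  by rewrite inE/= in_itv/= s0.
have H x := green_daniell x.
have b1 : Bb (cst 1 : E -> R) by exact: Bb_cst.
rewrite (_ : green X P f = (fun x => green X P (f \+ (fun x => supnorm f * cst 1 x)) x
    - supnorm f * green X P (cst 1) x)); last first.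
  apply/funext => x; rewrite (daniellD (H x))//; last exact: Bb_scale.
  by rewrite (daniellZ (H x))// addrK.
apply: measurable_funB; last by apply: measurable_funM => //; exact: pos.
apply: pos => [|x]; first by apply: Bb_add => //; exact: Bb_scale.
by rewrite /= mulr1 Bb_shift_ge0.
Qed.

Lemma green_operator : bounded_operator (green X P) (c / lambda).
Proof.
split=> [f|f M bf fM x|x].
- exact: measurable_green.
- exact: green_le.
- exact: green_daniell.
Qed.

(** Fubini's theorem exchanges Q_s with the time integral defining the Green
    operator, and the semigroup property merges Q_s Q_r into Q_(s+r). *)
Lemma transition_green (f : E -> R) s x : Bb f -> 0 < s ->
  (@lebesgue_measure R).-integrable D
    (EFin \o (fun r => transition (s + r) (extend f) (Some x))) /\
  transition s (extend (green X P f)) (Some x) =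
    Rintegral (@lebesgue_measure R) D
      (fun r => transition (s + r) (extend f) (Some x)).
Proof.
move=> bf s0; have fM y := supnorm_ub y bf; have bh := extend_Bb bf.
have DE := @half_line_gt0 R.
pose J (z : option E * measurableTypeR R) := Rintegral (path_law P z.1) setT
    (fun w => path_value (extend f) (w, z.2)).
have JE y r : 0 < r -> J (y, r) = transition r (extend f) y.
  by move=> r0; apply: eq_Rintegral => w _; rewrite path_value_time.
pose F (z : Omega * measurableTypeR R) := J (X s z.1, z.2).
have mF : measurable_fun setT F.
  apply: (measurableT_comp (measurable_transition bh)
      (g := fun z : Omega * measurableTypeR R => (X s z.1, z.2))).
  apply: measurable_fun_pair; last exact: measurable_snd.
  exact: (measurableT_comp (measurable_X (ltW s0)) measurable_fst).
have F0 w r : r <= 0 -> F (w, r) = 0.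
  move=> r0; rewrite /F /J /Rintegral integral0_eq// => w' _.
  by rewrite /path_value patchE memNset//= ltNge r0.
have FM z : `|F z| <= supnorm (extend f).
  case: z => w r; have [r0|r0] := ltP 0 r; last first.
    by rewrite F0// normr0; exact: supnorm_ge0 None bh.
  rewrite /F JE// -[leRHS]mul1r.
  by apply: (operator_le (transition_operator r0) bh) => y; exact: supnorm_ub.
have [|||||iG E1] := integral_time_swap
  (m := path_law P (Some x)) (F := F)
  (b := fun s => supnorm f * c * expR (- lambda * s)) (M := supnorm (extend f)).
- exact: mF.
- exact: F0.
- exact: FM.
- exact: integrable_bound.
- move=> r r0; have FB : measurable_fun setT (fun w => `|F (w, r)|).
    by do 2 apply: measurableT_comp => //; exact: measurable_pair2.
  have Fb w : `| `|F (w, r)| | <= supnorm f * c * expR (- lambda * r).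
    rewrite normr_id /F JE//; apply: transition_extend_le => //.
    exact: supnorm_ge0 x bf.
  have := daniell_norm (Rintegral_daniell (path_law P (Some x))) FB Fb.
  by rewrite probability_Rintegral1 mulr1; apply: le_trans; exact: ler_norm.
have GE r : 0 < r -> Rintegral (path_law P (Some x)) setT (fun w => F (w, r)) =
    transition (s + r) (extend f) (Some x).
  move=> r0; rewrite (transition_semigroup (Some x) s0 r0 bh).
  by apply: eq_Rintegral => w _; rewrite /F JE.
split.
  move: iG; apply: eq_integrable => // r /DE r0.
  by rewrite /= GE.
transitivity (fine (\int[path_law P (Some x)]_w
    \int[lebesgue_measure]_(r in D) (F (w, r))%:E)%E).
  congr fine; apply: eq_integral => w _.
  under [RHS]eq_integral => r rD do rewrite /F /= JE ?DE//.
  case: (X s w) => [y|].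
    rewrite -[extend _ (Some y)]/(green X P f y).
    have [iy ->] := green_transition y bf.
    by rewrite /Rintegral fineK//; exact: integrable_fin_num iy.
  by rewrite integral0_eq// => r Dr; rewrite transition_None// DE ?inE.
by rewrite E1; apply: eq_Rintegral => r /DE r0; rewrite GE.
Qed.
End green.
End transition.

(** * Survival: being alive and not being at the cemetery *)

(** The intervals from q s to p s are nonempty and pairwise disjoint, and each
    contains a rational. *)
Lemma countable_gaps (R : realType) (A : set R) (p q : R -> R) :
  (forall s, A s -> q s < p s) ->
  (forall s u, A s -> A u -> s < u -> p u <= q s) -> countable A.
Proof.
move=> qp pq.
have /choice[h hE] s : exists r : rat, A s -> q s < ratr r < p s.
  have [As|nAs] := pselect (A s); last by exists 0.
  by have [r] := rat_in_itvoo (qp _ As); rewrite in_itv/= => qrp; exists r.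
apply/countable_injP; exists (pickle \o h).
move=> s u /set_mem As /set_mem Au /= /(pcan_inj pickleK) hsu.
have main a b : A a -> A b -> h a = h b -> a < b -> False.
  move=> Aa Ab hab ab; have /andP[ha _] := hE _ Aa; have /andP[_ hb] := hE _ Ab.
  have := lt_le_trans hb (pq _ _ Aa Ab ab).
  by rewrite -hab => /(lt_trans ha); rewrite ltxx.
case: (ltgtP s u) => // su; exfalso.
  exact: main As Au hsu su.
exact: main Au As (esym hsu) su.
Qed.

Section survival_probability.
Context (R : realType) (d dO : measure_display)
  (E : measurableType d) (Omega : measurableType dO).
Variables (X : R -> Omega -> option E) (P : R.-pker (option E) ~> Omega).
Hypotheses (X_markov : markov_process X P) (X_absorbing : absorbing X).

Definition living : set (option E) := Some @` setT.

Lemma livingE y : living y <-> y <> None.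
Proof. by split=> [[x _ <-]//|]; case: y => // x _; exists x. Qed.

Lemma measurable_living (s : R) : 0 <= s -> measurable (X s @^-1` living).
Proof.
move=> s0; rewrite -[X in measurable X]setTI; apply: (measurable_X X_markov s0) => //.
exact: measurable_Some.
Qed.

Lemma alive_living (s : R) : 0 <= s -> alive X s `<=` X s @^-1` living.
Proof.
move=> s0 w; rewrite /alive /= => st; apply/livingE => Xs.
by have := lt_le_trans st (tau_le s0 Xs); rewrite ltxx.
Qed.

Lemma living_alive (u s : R) : u < s -> X s @^-1` living `<=` alive X u.
Proof.
move=> us w /livingE Xs; rewrite /alive /= ltNge; apply/negP => tu.
by apply/Xs/(tau_lt X_absorbing)/(le_lt_trans tu); rewrite lte_fin.
Qed.

Lemma measurable_alive (t : R) : 0 <= t -> measurable (alive X t).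
Proof.
move=> t0; pose u n : R := t + n.+1%:R^-1.
have u0 n : 0 <= u n by rewrite addr_ge0.
have -> : alive X t = \bigcup_n (X (u n) @^-1` living).
  apply/seteqP; split=> w; last first.
    by case=> n _; apply: living_alive; rewrite ltrDl invr_gt0.
  rewrite /alive /= => ttau; have [n un] : exists n, ((u n)%:E < tau X w)%E.
    case: (tau X w) ttau => [r| |]; last by [].
    - by rewrite lte_fin => /ltr_add_invr[n un]; exists n; rewrite lte_fin.
    - by exists 0%N; rewrite ltry.
  by exists n => //; exact: (alive_living (u0 n)).
by apply: bigcup_measurable => n _; exact: measurable_living.
Qed.

Lemma transition_living (s : R) x : 0 < s ->
  (transition X P s (extend (cst 1)) (Some x))%:E = P (Some x) (X s @^-1` living).
Proof.
move=> s0; rewrite -(transition_indic X_markov)//; last exact: measurable_Some.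
congr (transition _ _ _ _ _)%:E; apply/funext => -[y|] /=; rewrite indicE.
  by rewrite mem_set//; exists y.
by rewrite memNset//; case.
Qed.

Lemma fin_numP y A : measurable A -> P y A \is a fin_num.
Proof. exact: (fin_num_measure (path_law P y)). Qed.

Section bound.
Variables (c lambda : R).
Hypothesis survival_le : forall (t : R) (x : E), 0 <= t ->
  (P (Some x) (alive X t) <= (c * expR (- lambda * t))%:E)%E.

(** If X_s is in E then u < tau for every u < s, so the survival bound holds
    with u in place of s; let u tend to s. *)
Lemma transition_survival_le (s : R) x : 0 < s ->
  transition X P s (extend (cst 1)) (Some x) <= c * expR (- lambda * s).
Proof.
move=> s0; have H u : 0 <= u < s ->
    transition X P s (extend (cst 1)) (Some x) <= c * expR (- lambda * u).
  move=> /andP[u0 us]; rewrite -lee_fin transition_living//.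
  apply: le_trans (survival_le x u0); apply: (le_measure (path_law P (Some x))).
  - by rewrite inE; exact: measurable_living (ltW s0).
  - by rewrite inE; exact: measurable_alive.
  - exact: living_alive.
have cv : c * expR (- lambda * u) @[u --> s^'-] --> c * expR (- lambda * s).
  apply: cvg_at_left_filter; apply: cvgMr; apply: (continuous_comp (f := fun u => - lambda * u)).
    exact: mulrl_continuous.
  exact: continuous_expR.
apply: (ler_cvg_to (@cvg_cst _ _ _ _ _) cv).
near=> u; apply: H; apply/andP; split; last by [].
by near: u; apply: nbhs_left_ge.
Unshelve. all: by end_near.
Qed.
End bound.

(** The times s at which, with positive probability, s = tau although X_s is
    still in E. *)
Definition fleeting (x : E) : set R := [set s | 0 < s /\
  P (Some x) (alive X s) <> P (Some x) (X s @^-1` living)].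

(** The probability of X_s being in E is nonincreasing in s, and the probability
    of s < tau is its right limit: the fleeting times are its jumps. *)
Lemma countable_fleeting x : countable (fleeting x).
Proof.
apply: (countable_gaps (p := fun s => fine (P (Some x) (X s @^-1` living)))
  (q := fun s => fine (P (Some x) (alive X s)))).
  move=> s [s0 ne]; rewrite -lte_fin !fineK; last 2 first.
  - exact/fin_numP/measurable_living/ltW.
  - exact/fin_numP/measurable_alive/ltW.
  rewrite lt_neqAle; apply/andP; split; first exact/eqP.
  apply: (le_measure (path_law P (Some x))).
  - by rewrite inE; exact: measurable_alive (ltW s0).
  - by rewrite inE; exact: measurable_living (ltW s0).
  - exact: alive_living (ltW s0).
move=> s u [s0 _] [u0 _] su; rewrite -lee_fin !fineK; last 2 first.
- exact/fin_numP/measurable_alive/ltW.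
- exact/fin_numP/measurable_living/ltW.
apply: (le_measure (path_law P (Some x))).
- by rewrite inE; exact: measurable_living (ltW u0).
- by rewrite inE; exact: measurable_alive (ltW s0).
- exact: living_alive.
Qed.
End survival_probability.

(** * Estimates for the Green operator *)
Section variation_distance.
Context (R : realType) (d : measure_display) (T : measurableType d).

(** The supremum defining the distance, rescaled to functions of any norm. *)
Lemma tv_dist_daniell (L : (T -> R) -> R) (m : set T -> \bar R)
    (alpha : probability T R) (b : R) (f : T -> R) :
  daniell L -> (forall f, Bb f -> (\int[m]_x (f x)%:E = (L f)%:E)%E) ->
  (tv_dist m alpha <= b%:E)%E -> Bb f ->
  `|L f - Rintegral alpha setT f| <= b * supnorm f.
Proof.
move=> HL Lm mb bf; have [x0 _] := probability_nonempty alpha.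
have fM x := supnorm_ub x bf.
have Ha := Rintegral_daniell alpha.
have [s0|s0] := eqVneq (supnorm f) 0.
  have := daniell_norm HL (proj1 bf) fM; have := daniell_norm Ha (proj1 bf) fM.
  by rewrite s0 !mul0r !normr_le0 => /eqP -> /eqP ->; rewrite subrr normr0 mulr0.
have {}s0 : 0 < supnorm f by rewrite lt_neqAle eq_sym s0 (supnorm_ge0 x0).
pose g x := (supnorm f)^-1 * f x.
have bg : Bb g by exact: Bb_scale.
have g1 : supnorm g <= 1.
  apply: supnorm_le => [|x]; first by exists x0.
  by rewrite /g normrM ger0_norm ?invr_ge0 ?(ltW s0)// ler_pdivrMl// mulr1.
have : (`|\int[m]_x (g x)%:E - \int[alpha]_x (g x)%:E| <= b%:E)%E.
  by apply: le_trans mb; apply: ereal_sup_ubound; exists g.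
rewrite (Bb_RintegralE alpha bg) Lm// -EFinB abse_EFin lee_fin (daniellZ HL)// (daniellZ Ha)//.
by rewrite -mulrBr normrM ger0_norm ?invr_ge0 ?(ltW s0)// ler_pdivrMl// mulrC.
Qed.

Lemma Rintegral_gt0 (m : probability T R) (f : T -> R) :
  Bb f -> (forall x, 0 < f x) -> 0 < Rintegral m setT f.
Proof.
move=> bf f0; rewrite lt_neqAle Rintegral_ge0 ?andbT//; last by move=> x _; exact: ltW.
apply/negP => /eqP/esym I0.
have mf : measurable_fun setT (EFin \o f) by apply/measurable_EFinP; case: bf.
have : (\int[m]_x `|(EFin \o f) x| = 0)%E.
  under eq_integral do rewrite gee0_abs ?lee_fin ?(ltW (f0 _))//.
  by rewrite Bb_RintegralE// I0.
move=> /(ae_eq_integral_abs m measurableT mf)[N [mN N0 subN]].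
have NT : N = setT.
  rewrite -subTset => x _; apply: subN => /= /(_ I) [] fx.
  by have := f0 x; rewrite fx ltxx.
have := probability_setT m; rewrite -NT [LHS]N0 => /eqP.
by rewrite eqe eq_sym oner_eq0.
Qed.

Lemma act_estimate (S : (T -> R) -> T -> R) (c a b : R) (eta f : T -> R)
    (mu : probability T R) :
  bounded_operator S c -> Bb eta -> Bb f ->
  (forall x, `|S f x - a * eta x| <= b) ->
  `|act mu S f - a * Rintegral mu setT eta| <= b.
Proof.
move=> HS be bf Sb; have bS := operator_Bb HS bf.
have bE : Bb (fun x => - a * eta x) by exact: Bb_scale.
have Hm := Rintegral_daniell mu.
have -> : act mu S f - a * Rintegral mu setT eta =
    Rintegral mu setT (S f \+ (fun x => - a * eta x)).
  by rewrite (daniellD Hm)// (daniellZ Hm)// mulNr.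
have := daniell_norm Hm (proj1 (Bb_add bS bE)) (M := b).
by rewrite probability_Rintegral1 mulr1; apply => x; rewrite /= mulNr.
Qed.
End variation_distance.

Section estimates.
Context (R : realType) (d dO : measure_display)
  (E : measurableType d) (Omega : measurableType dO).
Variables (X : R -> Omega -> option E) (P : R.-pker (option E) ~> Omega).
Hypotheses (X_markov : markov_process X P) (X_absorbing : absorbing X).

Lemma law_dirac x A : measurable A -> law P (\d_x : probability E R) A = P (Some x) A.
Proof.
move=> mA; rewrite /law integral_dirac//.
  by rewrite diracT mul1e.
apply: (measurableT_comp (measurable_kernel P A mA)).
by move=> _ Y mY; rewrite setTI.
Qed.

(** Outside the fleeting times, conditioning on s < tau is conditioning on X_s
    being in E. *)
Lemma integral_cond_law x (s : R) (f : E -> R) : 0 < s -> ~ fleeting X P x s ->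
  Bb f ->
  (\int[cond_law X (law P (\d_x : probability E R)) s]_y (f y)%:E =
   (transition X P s (extend f) (Some x) /
    transition X P s (extend (cst 1)) (Some x))%:E)%E.
Proof.
move=> s0 nfs bf.
have HT := transition_extend_daniell X_markov (Some x) s0.
set p := transition X P s (extend (cst 1)) (Some x).
have p0 : 0 <= p by apply: (daniell_ge0 HT); [exact: Bb_cst|].
have HL := daniell_div HT p0.
have PE : P (Some x) (alive X s) = P (Some x) (X s @^-1` living (E := E)).
  by apply: contrapT => ne; apply: nfs.
have mA := measurable_alive X_markov X_absorbing (ltW s0).
rewrite -(integral_daniell_measure HL bf); apply: eq_integral_measurable => B mB.
have mL := measurable_living X_markov (ltW s0).
have mSB : measurable (X s @^-1` (Some @` B)).
  rewrite -[X in measurable X]setTI; apply: (measurable_X X_markov (ltW s0)) => //.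
  exact: measurable_Some.
rewrite /cond_law !law_dirac//; last exact: measurableI.
congr (_ / _)%:E; last by rewrite PE -(transition_living X_markov x s0).
have -> : extend \1_B = \1_(Some @` B) :> (option E -> R).
  apply/funext => -[y|] /=; rewrite !indicE.
    congr (nat_of_bool _)%:R; apply/idP/idP; rewrite !inE; first by move=> By; exists y.
    by case=> z Bz [<-].
  by rewrite memNset//; case.
apply: EFin_inj; rewrite transition_indic//; last exact: measurable_Some.
rewrite fineK; last by apply: fin_numP; exact: measurableI.
set A := X s @^-1` (Some @` B).
have AD0 : path_law P (Some x) (A `\` alive X s) = 0%E.
  have LD0 : path_law P (Some x) (X s @^-1` living (E := E) `\` alive X s) = 0%E.
    rewrite measureD//; last first.
      by rewrite ltey_eq (fin_num_measure (path_law P (Some x)) _ mL).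
    rewrite setIidr; last exact: alive_living (ltW s0).
    by rewrite [X in (_ - X)%E]PE subee//; exact: (fin_num_measure (path_law P (Some x)) _ mL).
  apply: (subset_measure0 _ _ _ LD0).
  - exact: measurableD.
  - exact: measurableD.
  - by apply: setSD => w [y _ Xy]; exists y.
by have := measureDI (path_law P (Some x)) mSB mA; rewrite [X in (X + _)%E]AD0 add0e => /esym.
Qed.
Section convergence.
Variables (alpha : probability E R) (lambda gamma C C' C'' : R) (eta : E -> R).
Hypotheses (alive_gt0 : forall (t : R) (x : E), 0 <= t ->
     (0 < P (Some x) (alive X t))%E)
  (lambda_gt0 : 0 < lambda) (gamma_gt0 : 0 < gamma)
  (C_gt0 : 0 < C) (C'_gt0 : 0 < C') (C''_gt0 : 0 < C'')
  (cvg_qsd : forall (t : R) (mu : probability E R), 0 <= t ->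
     (tv_dist (cond_law X (law P mu) t) alpha
        <= (C * expR (- gamma * t))%:E)%E)
  (cvg_eta : forall (t : R) (x : E), 0 <= t ->
     `|expR (lambda * t) * fine (P (Some x) (alive X t)) - eta x|
       <= C' * expR (- gamma * t))
  (survival_le : forall (t : R) (x : E), 0 <= t ->
     (P (Some x) (alive X t) <= (C'' * expR (- lambda * t))%:E)%E).

Let K := C * C'' + C'.
Let K_ge0 : 0 <= K.
Proof. by rewrite addr_ge0// ?mulr_ge0// ltW. Qed.
Let kappa_gt0 : 0 < lambda + gamma. Proof. exact: addr_gt0. Qed.

Let trans s f x := transition X P s (extend f) (Some x).
Let mean f := Rintegral alpha setT f.

Let Tr s x (s0 : 0 < s) : daniell (fun f => trans s f x) :=
  transition_extend_daniell X_markov (Some x) s0.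
Let survival s x (s0 : 0 < s) : trans s (cst 1) x <= C'' * expR (- lambda * s) :=
  transition_survival_le X_markov X_absorbing survival_le x s0.

Let expR_split s :
  expR (- (lambda + gamma) * s) = expR (- lambda * s) * expR (- gamma * s).
Proof. by rewrite -expRD; congr expR; ring. Qed.

Let mean_le f : Bb f -> `|mean f| <= supnorm f.
Proof.
move=> bf; have := daniell_norm (Rintegral_daniell alpha) (proj1 bf)
  (fun x => supnorm_ub x bf).
by rewrite probability_Rintegral1 mulr1.
Qed.

(** With p the survival probability at time s, the difference splits as
    (Q_s f - alpha(f) p) + alpha(f) (p - eta(x) e^(-lambda s)). The first part
    is p times the distance from the conditioned law to alpha, and p itself is
    at most C'' e^(-lambda s); the second is the convergence of the rescaled
    survival probability to eta. *)
Lemma transition_estimate (f : E -> R) x s : Bb f -> 0 < s -> ~ fleeting X P x s ->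
  `|trans s f x - mean f * eta x * expR (- lambda * s)|
    <= K * supnorm f * expR (- (lambda + gamma) * s).
Proof.
move=> bf s0 nfs; set p := trans s (cst 1) x.
have pE : fine (P (Some x) (alive X s)) = p.
  rewrite (_ : P _ _ = P (Some x) (X s @^-1` living (E := E))); last first.
    by apply: contrapT => ne; apply: nfs.
  by rewrite -(transition_living X_markov x s0).
have p0 : 0 < p.
  rewrite -pE fine_gt0// alive_gt0 ?(ltW s0)//=.
  have mA := measurable_alive X_markov X_absorbing (ltW s0).
  by rewrite ltey_eq (fin_num_measure (path_law P (Some x)) _ mA).
have pC : p <= C'' * expR (- lambda * s) by exact: survival.
have sup0 : 0 <= supnorm f by exact: supnorm_ge0 x bf.
have HL := daniell_div (Tr x s0) (ltW p0).
have h1 := tv_dist_daniell HL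
  (fun g bg => integral_cond_law s0 nfs bg)
  (cvg_qsd (\d_x : probability E R) (ltW s0)) bf.
have h2 := cvg_eta x (ltW s0); rewrite pE in h2.
have {}h1 : `|trans s f x - mean f * p| <=
    C * expR (- gamma * s) * supnorm f * (C'' * expR (- lambda * s)).
  rewrite (_ : trans s f x - mean f * p = (trans s f x / p - mean f) * p); last first.
    by field; rewrite gt_eqF.
  rewrite normrM (gtr0_norm p0); apply: ler_pM => //; exact: ltW.
have {}h2 : `|mean f * (p - eta x * expR (- lambda * s))| <=
    supnorm f * (C' * expR (- gamma * s) * expR (- lambda * s)).
  rewrite normrM; apply: ler_pM => //; first exact: mean_le.
  rewrite (_ : p - _ = (expR (lambda * s) * p - eta x) * expR (- lambda * s)); last first.
    by rewrite mulrBl mulrAC -expRD mulNr subrr expR0 mul1r.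
  by rewrite normrM (ger0_norm (expR_ge0 _)) ler_wpM2r ?expR_ge0.
have -> : trans s f x - mean f * eta x * expR (- lambda * s) =
  (trans s f x - mean f * p) + mean f * (p - eta x * expR (- lambda * s)) by ring.
rewrite (le_trans (ler_normD _ _))// (le_trans (lerD h1 h2))//.
by rewrite expR_split /K le_eqVlt; apply/orP; left; apply/eqP; ring.
Qed.

Let green_op : bounded_operator (green X P) (C'' / lambda) :=
  green_operator X_markov X_absorbing lambda_gt0 (ltW C''_gt0) survival.

Lemma green_iter_operator n :
  bounded_operator (green_iter X P n) ((C'' / lambda) ^+ n).
Proof. exact: bounded_operator_iter. Qed.

Lemma green_exp_operator (t : R) : 0 <= t ->
  bounded_operator (green_exp X P t) (expR (t * (C'' / lambda))).
Proof. exact: bounded_operator_exp. Qed.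

(** Induction on n: Q_s A^(n+1) f is the integral over r > 0 of Q_(s+r) A^n f,
    and the estimate at time s + r is integrated in r. The times r with s + r
    fleeting are exceptional, but they are countably many. *)
Lemma green_iter_transition n (f : E -> R) x s :
  Bb f -> 0 < s -> ~ fleeting X P x s ->
  `|trans s (green_iter X P n f) x
     - mean f * eta x * expR (- lambda * s) / lambda ^+ n|
    <= K * supnorm f * expR (- (lambda + gamma) * s) / (lambda + gamma) ^+ n.
Proof.
move=> bf; elim: n s => [|n IH] s s0 nfs.
  by rewrite !expr0 !divr1; exact: transition_estimate.
have bA : Bb (green_iter X P n f) by exact: operator_Bb (green_iter_operator n) bf.
have [ih] := transition_green X_markov X_absorbing lambda_gt0 (ltW C''_gt0)
  survival x bA s0.
rewrite -[X in X = _]/(trans s (green_iter X P n.+1 f) x) => ->.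
have := Rintegral_expR_estimate
  (h := fun r => trans (s + r) (green_iter X P n f) x)
  (N := (fun u => u - s) @` fleeting X P x)
  (a := mean f * eta x * expR (- lambda * s) / lambda ^+ n)
  (K := K * supnorm f * expR (- (lambda + gamma) * s) / (lambda + gamma) ^+ n)
  lambda_gt0 kappa_gt0.
rewrite !exprSr !invfM !mulrA; apply => //.
- rewrite !mulr_ge0 ?invr_ge0 ?exprn_ge0 ?expR_ge0 ?(ltW kappa_gt0)//.
  exact: supnorm_ge0 x bf.
- exact: sub_countable (card_image_le _ _) (countable_fleeting X_markov X_absorbing x).
- move=> r r0 Nr; have nfsr : ~ fleeting X P x (s + r).
    by move=> fsr; apply: Nr; exists (s + r) => //; rewrite addrAC subrr add0r.
  have expD k : expR (k * (s + r)) = expR (k * s) * expR (k * r).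
    by rewrite mulrDr expRD.
  have := IH (s + r) (addr_gt0 s0 r0) nfsr; rewrite !expD !mulrA.
  by rewrite [X in _ - X]mulrAC [leRHS]mulrAC.
Qed.

Lemma green_iter_estimate n (f : E -> R) x : Bb f -> (1 <= n)%N ->
  `|green_iter X P n f x - mean f / lambda ^+ n * eta x|
    <= K * supnorm f / (lambda + gamma) ^+ n.
Proof.
case: n => // n bf _.
have bA : Bb (green_iter X P n f) by exact: operator_Bb (green_iter_operator n) bf.
have [ih] := green_transition X_markov X_absorbing lambda_gt0 (ltW C''_gt0)
  survival x bA.
rewrite -[X in X = _]/(green_iter X P n.+1 f x) => ->.
have := Rintegral_expR_estimate
  (h := fun r => trans r (green_iter X P n f) x)
  (N := fleeting X P x)
  (a := mean f * eta x / lambda ^+ n)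
  (K := K * supnorm f / (lambda + gamma) ^+ n)
  lambda_gt0 kappa_gt0.
rewrite !exprSr !invfM !mulrA [X in _ - X / _]mulrAC [X in _ - X]mulrAC.
apply => //.
- rewrite !mulr_ge0 ?invr_ge0 ?exprn_ge0 ?expR_ge0 ?(ltW kappa_gt0)//.
  exact: supnorm_ge0 x bf.
- exact: countable_fleeting.
- move=> r r0 Nr; have := green_iter_transition n bf r0 Nr.
  by rewrite [X in _ - X]mulrAC [leRHS]mulrAC.
Qed.

Let eta_le x : `|eta x| <= 1 + C'.
Proof.
have := cvg_eta x (lexx 0); rewrite !mulr0 expR0 mul1r mulr1 => h.
have -> : eta x = fine (P (Some x) (alive X 0))
    - (fine (P (Some x) (alive X 0)) - eta x) by ring.
rewrite (le_trans (ler_normB _ _))// lerD//.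
have mA := measurable_alive X_markov X_absorbing (lexx 0).
rewrite ger0_norm ?fine_ge0// -lee_fin fineK ?(fin_num_measure (path_law P (Some x)) _ mA)//.
exact: (probability_le1 (path_law P (Some x)) mA).
Qed.

(** At n = 0 the quantity to bound is f - alpha(f) eta, of size at most
    |f| (1 + sup eta) <= |f| (2 + C'); the exponential series needs one constant
    for all n. *)
Let K' := K + 2 + C'.

Lemma green_iter_estimate_from0 n (f : E -> R) x : Bb f ->
  `|green_iter X P n f x - mean f / lambda ^+ n * eta x|
    <= K' * supnorm f / (lambda + gamma) ^+ n.
Proof.
move=> bf; have sup0 : 0 <= supnorm f by exact: supnorm_ge0 x bf.
have [->|n1] := posnP n; last first.
  apply: le_trans (green_iter_estimate x bf n1) _.
  rewrite ler_wpM2r ?invr_ge0 ?exprn_ge0 ?(ltW kappa_gt0)//.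
  by rewrite ler_wpM2r// /K' -addrA lerDl addr_ge0// ?(ltW C'_gt0).
rewrite !expr0 !divr1 (le_trans (ler_normB _ _))//.
have : `|f x| + `|mean f * eta x| <= supnorm f + supnorm f * (1 + C').
  by rewrite lerD ?supnorm_ub// normrM ler_pM// mean_le.
move=> /le_trans; apply.
have -> : supnorm f + supnorm f * (1 + C') = (2 + C') * supnorm f by ring.
by apply: ler_wpM2r => //; rewrite /K' -(addrA K) lerDr.
Qed.

Lemma green_exp_estimate (f : E -> R) x t : Bb f -> 0 <= t ->
  `|green_exp X P t f x - mean f * expR (t / lambda) * eta x|
    <= K' * supnorm f * expR (t / (lambda + gamma)).
Proof.
move=> bf t0.
pose u k := t ^+ k / k`!%:R *
  (green_iter X P k f x - mean f / lambda ^+ k * eta x).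
pose b k := K' * supnorm f * exp_coeff (t / (lambda + gamma)) k.
have cb : series b @ \oo --> K' * supnorm f * expR (t / (lambda + gamma)).
  exact: cvg_series_exp_coeff.
have cu : series u @ \oo --> green_exp X P t f x - mean f * expR (t / lambda) * eta x.
  rewrite (_ : series u = series (fun k => t ^+ k / k`!%:R * iter k (green X P) f x)
     \- series (fun k => (mean f * eta x) * exp_coeff (t / lambda) k)).
    rewrite (mulrAC (mean f)); apply: cvgB; last exact: cvg_series_exp_coeff.
    exact: (operator_exp_cvg green_op t0 bf).
  apply/funext => n; rewrite /series /= -sumrB; apply: eq_bigr => k _.
  rewrite /u mulrBr; congr (_ - _).
  by rewrite /exp_coeff /= expr_div_n; ring.
have ub k : `|u k| <= b k.
  rewrite /u normrM ger0_norm ?divr_ge0 ?exprn_ge0//.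
  apply: le_trans (ler_wpM2l _ (green_iter_estimate_from0 k x bf)) _.
    by rewrite divr_ge0 ?exprn_ge0.
  by rewrite /b /exp_coeff /= expr_div_n le_eqVlt; apply/orP; left; apply/eqP; ring.
have cb' : cvgn (series b) by apply/cvg_ex; eexists; exact: cb.
have := (dominated_series ub cb').2 0%N.
have S0 (v : nat -> R) : series v 0%N = 0 by rewrite /series /= big_geq.
by rewrite !S0 !subr0 (cvg_lim _ cu)// (cvg_lim _ cb).
Qed.

End convergence.
End estimates.

Theorem proposition3p1 (R : realType) (d dO : measure_display)
  (E : measurableType d) (Omega : measurableType dO)
  (X : R -> Omega -> option E) (P : R.-pker (option E) ~> Omega)
  (X_markov : markov_process X P)
  (X_absorbing : absorbing X)
  (tau_finite : forall x : E, {ae P (Some x), forall w, (tau X w < +oo)%E})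
  (alive_gt0 : forall (t : R) (x : E), 0 <= t ->
     (0 < P (Some x) (alive X t))%E)
  (* the two conditions *)
  (nu : probability E R) (t0 c1 c2 : R)
  (t0_gt0 : 0 < t0) (c1_gt0 : 0 < c1) (c2_gt0 : 0 < c2)
  (minorization : forall (x : E) (B : set E), measurable B ->
     (cond_law X (P (Some x)) t0 B >= c1%:E * nu B)%E)
  (survival_comparison : forall (t : R) (x : E), 0 <= t ->
     (law P nu (alive X t) >= c2%:E * P (Some x) (alive X t))%E)
  (* the known facts fixing alpha, lambda0, eta and the constants *)
  (alpha : probability E R) (lambda0 : R) (eta : E -> R)
  (C C' C'' gamma t1 D : R)
  (alpha_qsd : quasi_stationary X P alpha)
  (alpha_unique : forall beta : probability E R, quasi_stationary X P beta ->
     forall B : set E, measurable B -> beta B = alpha B)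
  (lambda0_gt0 : 0 < lambda0)
  (alpha_survival : forall t : R, 0 <= t ->
     law P alpha (alive X t) = (expR (- lambda0 * t))%:E)
  (eta_Bb : Bb eta) (eta_ge0 : forall x : E, 0 <= eta x)
  (alpha_eta : (\int[alpha]_x (eta x)%:E = 1)%E)
  (C_gt0 : 0 < C) (C'_gt0 : 0 < C') (C''_gt0 : 0 < C'') (gamma_gt0 : 0 < gamma)
  (cvg_qsd : forall (t : R) (mu : probability E R), 0 <= t ->
     (tv_dist (cond_law X (law P mu) t) alpha
        <= (C * expR (- gamma * t))%:E)%E)
  (cvg_eta : forall (t : R) (x : E), 0 <= t ->
     `|expR (lambda0 * t) * fine (P (Some x) (alive X t)) - eta x|
       <= C' * expR (- gamma * t))
  (survival_le : forall (t : R) (x : E), 0 <= t ->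
     (P (Some x) (alive X t) <= (C'' * expR (- lambda0 * t))%:E)%E)
  (t1_gt0 : 0 < t1)
  (D_t1 : D * expR (- gamma * t1) <= 2^-1)
  (cvg_eta_relative : forall (t : R) (x : E), t1 <= t ->
     `|expR (lambda0 * t) * fine (P (Some x) (alive X t)) - eta x|
       <= D * eta x * expR (- gamma * t)) :
  (forall (mu : probability E R) (f : E -> R) (n : nat), Bb f -> (1 <= n)%N ->
     `|act mu (green_iter X P n) f
       - Rintegral alpha setT f * Rintegral mu setT eta / lambda0 ^+ n|
       <= (C * C'' + C') * supnorm f / (lambda0 + gamma) ^+ n)
  /\
  exists B : R,
    (forall (mu : probability E R) (n : nat), (1 <= n)%N ->
       (tv_dist (normalized mu (green_iter X P n)) alpha
          <= (B / Rintegral mu setT eta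
                * (lambda0 / (lambda0 + gamma)) ^+ n)%:E)%E)
    /\
    (forall (mu : probability E R) (t : R), 0 <= t ->
       (tv_dist (normalized mu (green_exp X P t)) alpha
          <= (B / Rintegral mu setT eta
                * expR (- t * (gamma / (lambda0 * (lambda0 + gamma)))))%:E)%E).
Proof.
(* if eta vanished at x, the relative estimate at time t1 would leave no
   survival from x *)
have eta_gt0 x : 0 < eta x.
  rewrite lt_neqAle eta_ge0 andbT; apply/negP => /eqP/esym eta0.
  have := cvg_eta_relative t1 x (lexx _).
  rewrite eta0 subr0 mulr0 mul0r normr_le0 mulf_eq0 gt_eqF ?expR_gt0//= => /eqP P0.
  have mA := measurable_alive X_markov X_absorbing (ltW t1_gt0).
  have := alive_gt0 t1 x (ltW t1_gt0).
  by rewrite -[X in (_ < X)%E]fineK ?P0 ?ltxx// (fin_num_measure (path_law P (Some x)) _ mA).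
pose A_op n := green_iter_operator X_markov X_absorbing lambda0_gt0 C''_gt0
  survival_le n.
have kappa_gt0 : 0 < lambda0 + gamma by exact: addr_gt0.
have m_gt0 (mu : probability E R) : 0 < Rintegral mu setT eta by exact: Rintegral_gt0.
split.
  move=> mu f n bf n1; rewrite mulrAC.
  apply: (act_estimate mu (A_op n) eta_Bb bf) => x.
  by apply: (green_iter_estimate X_markov X_absorbing alive_gt0 lambda0_gt0
    gamma_gt0 C_gt0 C'_gt0 C''_gt0 cvg_qsd cvg_eta survival_le).
set K' : R := C * C'' + C' + 2 + C'.
exists (4 * K'); split=> [mu n n1|mu t t_ge0].
  have HL := act_daniell mu (A_op n).
  have k0 : 0 < Rintegral mu setT eta / lambda0 ^+ n by rewrite divr_gt0 ?exprn_gt0.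
  apply: le_trans (tv_dist_normalized_le HL k0 (b := K' / (lambda0 + gamma) ^+ n) _) _.
    move=> f bf; rewrite mulrA mulrAC [leRHS]mulrAC.
    apply: (act_estimate mu (A_op n) eta_Bb bf) => x.
    by apply: (green_iter_estimate_from0 X_markov X_absorbing alive_gt0 lambda0_gt0
      gamma_gt0 C_gt0 C'_gt0 C''_gt0 cvg_qsd cvg_eta survival_le).
  rewrite lee_fin expr_div_n invf_div le_eqVlt; apply/orP; left; apply/eqP; ring.
have E_op := green_exp_operator X_markov X_absorbing lambda0_gt0 C''_gt0
  survival_le t_ge0.
have HL := act_daniell mu E_op.
have k0 : 0 < Rintegral mu setT eta * expR (t / lambda0) by rewrite mulr_gt0 ?expR_gt0.
apply: le_trans (tv_dist_normalized_le HL k0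
  (b := K' * expR (t / (lambda0 + gamma))) _) _.
  move=> f bf; rewrite mulrA mulrAC [leRHS]mulrAC.
  apply: (act_estimate mu E_op eta_Bb bf) => x.
  by apply: (green_exp_estimate X_markov X_absorbing alive_gt0 lambda0_gt0
    gamma_gt0 C_gt0 C'_gt0 C''_gt0 cvg_qsd cvg_eta survival_le).
have -> : - t * (gamma / (lambda0 * (lambda0 + gamma))) =
    t / (lambda0 + gamma) - t / lambda0.
  by field; rewrite !gt_eqF.
rewrite lee_fin expRB invfM le_eqVlt; apply/orP; left; apply/eqP; ring.
Qed.
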